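(* Let $q$ be a power of a prime. For any Hermitian code $C_m$ over $\mathbb{F}_{q^2}$, the support $D$ of every minimum-weight codeword of $C_m$ is of one of the following two types: (i) $D$ is the complete intersection of the Hermitian curve $\mathcal{H}$ and a curve $\mathcal{X}$; (ii) $D$ is the complete intersection of two curves $\mathcal{X}$ and $\mathcal{Y}$, neither of which can be $\mathcal{H}$ (that is, $D$ is a complete intersection of two plane curves, but is not the complete intersection of $\mathcal{H}$ with any curve). If the distance of the code $C_m$ is lower than $q$, then all the supports of its minimum-weight codewords are of type (ii). For the codes with distance at least $q$, the supports of minimum-weight codewords are all of type (i), except for some special codes, each having distance $\mu q$ for some integer $\mu\le q$, for which both types of support are present. In other words: if $C_m$ has distance at least $q$, then either all supports of its minimum-weight codewords are of type (i), or its distance equals $\mu q$ with $\mu\leq q$ and it has minimum-weight codewords with support of type (i) and minimum-weight codewords with support of type (ii); codes of the latter kind do occur.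
   Context: $q$ is a power of a prime, $\mathbb{F}_{q^2}$ is the field with $q^2$ elements, $A=\mathbb{F}_{q^2}[x,y]$. The Hermitian curve $\mathcal{H}$ is the affine plane curve defined by $H=x^{q+1}-y^q-y$. It has exactly $n=q^3$ points with coordinates in $\mathbb{F}_{q^2}$, denoted $P_1,\dots,P_n$; put $E=\{P_1,\dots,P_n\}$, $I_E=\langle H, x^{q^2}-x,y^{q^2}-y\rangle$ and $A_E=A/I_E$. Weights: $w(x^ry^s)=rq+s(q+1)$. For an integer $m\ge 0$, $V_m\subseteq A_E$ is the $\mathbb{F}_{q^2}$-subspace spanned by the classes of the monomials $x^ry^s$ with $w(x^ry^s)\le m$. Let $\phi_E:A_E\to(\mathbb{F}_{q^2})^n$, $f\mapsto (f(P_1),\dots,f(P_n))$. The Hermitian code $C_m\subseteq(\mathbb{F}_{q^2})^n$ is the dual code (orthogonal complement with respect to the standard bilinear form) of $\phi_E(V_m)$. Here $0\le m\le q^3+q^2-q-2$. The distance of $C_m$ is the minimum weight (number of nonzero entries) of its nonzero codewords; a minimum-weight codeword is a nonzero codeword of that weight. The support of a codeword $\mathbf{c}=(c_1,\dots,c_n)$ is identified with the set of points $\{P_i : c_i\ne 0\}\subseteq E$. Curves are affine plane curves defined by polynomials in $A$. For a set $D\subseteq E$, $I_D\subset A$ is the ideal of all polynomials vanishing on $D$. $D$ is the complete intersection of the curves $F=0$ and $G=0$ if $I_D=\langle F,G\rangle$ (the scheme-theoretic intersection of the two affine curves is the reduced set $D$). *)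

(* Defs.v *)
From HB Require Import structures.
From mathcomp Require Import all_boot all_order all_algebra.
From mathcomp Require Import mpoly boolp.

Set Implicit Arguments.
Unset Strict Implicit.
Unset Printing Implicit Defensive.

Import GRing.Theory.

Local Open Scope ring_scope.

(* A point (x, y) of the affine plane over F is the pair of its coordinates,
   indexed by 'I_2: x is coordinate 0 and y is coordinate 1, so that the value
   of f : {mpoly F[2]} at P is f.@[P]. *)
Notation point F := {ffun 'I_2 -> F}.

Definition ideal_generated (R : comNzRingType) (s : seq R) (f : R) : Prop :=
  exists a : 'I_(size s) -> R, f = \sum_(i < size s) a i * s`_i.

Definition vanishing_ideal (F : finFieldType) (D : {set point F})
    (f : {mpoly F[2]}) : Prop :=
  forall P, P \in D -> f.@[P] = 0.

Definition complete_intersection (F : finFieldType) (D : {set point F})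
    (f g : {mpoly F[2]}) : Prop :=
  forall h, vanishing_ideal D h <-> ideal_generated [:: f; g] h.

Definition hermitian_poly (F : finFieldType) (q : nat) : {mpoly F[2]} :=
  'X_0 ^+ q.+1 - 'X_1 ^+ q - 'X_1.

Definition hermitian_points (F : finFieldType) (q : nat) : {set point F} :=
  [set P : point F | (hermitian_poly F q).@[P] == 0].

Definition hermitian_ideal (F : finFieldType) (q : nat) :
    {mpoly F[2]} -> Prop :=
  ideal_generated [:: hermitian_poly F q;
                      'X_0 ^+ (q ^ 2)%N - 'X_0; 'X_1 ^+ (q ^ 2)%N - 'X_1].

Definition weight (q : nat) (mon : 'X_{1..2}) : nat :=
  (mon 0%R * q + mon 1%R * q.+1)%N.

(* Subsets of the quotient F[x,y] / I are represented by their preimages in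
   F[x,y]: hermitian_space F q m is the set of all polynomials whose class
   modulo hermitian_ideal F q is an F-linear combination of classes of
   monomials of weight at most m. *)
Definition hermitian_space (F : finFieldType) (q m : nat)
    (f : {mpoly F[2]}) : Prop :=
  exists2 g : {mpoly F[2]},
    {in msupp g, forall mon, (weight q mon <= m)%N} &
    hermitian_ideal q (f - g).

(* The length of the code is #|hermitian_points F q|, which is q ^ 3 when
   #|F| = q ^ 2. *)
Definition hermitian_point (F : finFieldType) (q : nat)
    (i : 'I_#|hermitian_points F q|) : point F := enum_val i.

Definition hermitian_eval (F : finFieldType) (q : nat) (f : {mpoly F[2]}) :
    'rV[F]_#|hermitian_points F q| :=
  \row_i f.@[hermitian_point i].

Definition dual_code (F : finFieldType) (n : nat) (W : 'rV[F]_n -> Prop) :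
    {set 'rV[F]_n} :=
  [set c : 'rV[F]_n | `[< forall v, W v -> \sum_i c 0 i * v 0 i = 0 >]].

Definition hermitian_code (F : finFieldType) (q m : nat) :
    {set 'rV[F]_#|hermitian_points F q|} :=
  dual_code (fun v => exists2 f, hermitian_space q m f
                               & v = hermitian_eval q f).

Definition hamming_weight (F : finFieldType) (n : nat) (c : 'rV[F]_n) : nat :=
  #|[set i | c 0 i != 0]|.

(* As hamming_weight is at most n, the value n of the empty minimum only
   matters as a convention for the zero code. *)
Definition distance (F : finFieldType) (n : nat) (C : {set 'rV[F]_n}) : nat :=
  \big[minn/n]_(c in C | c != 0) hamming_weight c.

Definition min_weight_codeword (F : finFieldType) (n : nat)
    (C : {set 'rV[F]_n}) (c : 'rV[F]_n) : Prop :=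
  [/\ c \in C, c != 0 & hamming_weight c = distance C].

Definition codeword_support (F : finFieldType) (q : nat)
    (c : 'rV[F]_#|hermitian_points F q|) : {set point F} :=
  [set hermitian_point i | i in [set i | c 0 i != 0]].

Definition type_i (F : finFieldType) (q : nat) (D : {set point F}) : Prop :=
  exists g, complete_intersection D (hermitian_poly F q) g.

Definition type_ii (F : finFieldType) (q : nat) (D : {set point F}) : Prop :=
  (exists f g, complete_intersection D f g) /\ ~ type_i q D.

Definition all_supports_type_i (F : finFieldType) (q m : nat) : Prop :=
  forall c, min_weight_codeword (hermitian_code F q m) c ->
    type_i q (codeword_support c).

Definition all_supports_type_ii (F : finFieldType) (q m : nat) : Prop :=
  forall c, min_weight_codeword (hermitian_code F q m) c ->
    type_ii q (codeword_support c).

Definition mixed_supports (F : finFieldType) (q m : nat) : Prop :=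
  [/\ exists2 mu, (mu <= q)%N & distance (hermitian_code F q m) = (mu * q)%N,
      exists2 c, min_weight_codeword (hermitian_code F q m) c
               & type_i q (codeword_support c)
    & exists2 c, min_weight_codeword (hermitian_code F q m) c
               & type_ii q (codeword_support c)].

(* Main.v *)
From HB Require Import structures.
Require Import Defs.
From mathcomp Require Import all_boot all_order all_algebra.
From mathcomp Require Import mpoly finfield boolp.
From mathcomp Require Import zify ring.

(** Give x and y the weights q and q + 1. Both leading monomials of H have
    weight q (q + 1), so modulo H all monomials of one weight agree up to
    lower weight, and the classes of the x^r y^s with s < q form a basis of
    A / (H) with pairwise distinct weights. The top coefficient
    (topcoef, below) is multiplicative and well defined modulo H
    (topcoef_multiple): it is the pole order valuation at infinity of the
    curve, in elementary clothes.

    Let D be a set of points of the curve and lambda = w(x^a y^b), with b < q,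
    a weight that no element of I_D has as its leading weight. If a monomial
    divides lambda in the weight semigroup, its weight is no leading weight of
    I_D either, for otherwise multiplication by the cofactor would produce
    lambda. Hence these divisors of lambda are independent on D and |D| is at
    least their number nu (a, b) (nu_le_card). A nonzero word of C_m has such a
    lambda > m for its support, because otherwise every polynomial would be
    congruent modulo I_D to one of weight at most m, and the word would
    annihilate the indicator functions of points (exists_no_lead). This bound
    is attained for each admissible (a, b): the sum over all points of the
    curve of a polynomial of weight less than q^3 + q^2 - q - 1 vanishes
    (sum_points_below), so the values of a suitable product of vertical and
    horizontal lines form a word of weight exactly nu (a, b)
    (exists_codeword). So a minimum-weight support D satisfies
    |D| = nu (a, b), and then the divisors of lambda form a basis of A / I_D,
    which determines all leading weights of I_D.

    If a >= q or b = q - 1, the leading weights of I_D are the multiples of a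
    single weight, and a polynomial of I_D with that weight generates I_D
    together with H (type_i_support). If a < q and b < q - 1, there are
    polynomials in I_D with leading monomials x^(a+1) and y^(b+1); they generate
    I_D, and since these two weights have no common divisor in the semigroup,
    I_D is not generated by H and one more polynomial (type_ii_support,
    not_type_i).

    What remains is arithmetic of nu. The value nu (a, b) is at least q in the
    first case, so a distance below q forces type (ii). If the distance is at
    least q and some minimum-weight support is of type (ii), comparing (a, b)
    with larger weights gives a = q - 1 (nu_ge_type_ii), so the distance is
    (b + 1) q, and x^b y^(q-1), which has larger weight and the same nu, yields
    a minimum-weight word with support of type (i). For m = q^2 - q - 1 the
    distance is q, and q points of the curve on a line y = t form a support
    that is not of type (i). *)

(** * The weight filtration and its top coefficient *)

(** The substitution x -> x t^q, y -> y t^(q+1), a ring morphism into a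
    polynomial ring over a domain: the degree in t is the weight, and the
    leading coefficient in t is the top weighted form. Multiplicativity of
    weights and of leading forms is inherited from polynomials in t. *)
HB.lock Definition grading (F : finFieldType) (q : nat) :
    {mpoly F[2]} -> {poly {mpoly F[2]}} :=
  mmap (polyC \o @mpolyC 2 F)
    (fun i : 'I_2 => 'X_i *: 'X^(if i == 0 then q else q.+1))%R.

Section Grading.
Set Implicit Arguments.
Unset Strict Implicit.
Unset Printing Implicit Defensive.
Import GRing.Theory.
Local Open Scope ring_scope.

Variables (F : finFieldType) (q : nat).
Notation A := {mpoly F[2]}.
Notation H := (hermitian_poly F q).

Definition mono (r s : nat) : A := 'X_0 ^+ r * 'X_1 ^+ s.

Definition wt (r s : nat) : nat := (r * q + s * q.+1)%N.

Lemma mpolyX_mono (mon : 'X_{1..2}) : 'X_[mon] = mono (mon 0) (mon 1).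
Proof.
rewrite mpolyXE_id 2!big_ord_recl big_ord0 mulr1 /mono.
by congr ('X_ _ ^+ (mon _) * 'X_ _ ^+ (mon _)); apply: val_inj.
Qed.

Lemma mono_mpolyX r s : mono r s = 'X_[U_(0) *+ r + U_(1) *+ s].
Proof. by rewrite mpolyXD -!mpolyXn. Qed.

Lemma monoM r s r' s' : mono r s * mono r' s' = mono (r + r') (s + s').
Proof. by rewrite /mono mulrACA !exprD. Qed.

Lemma monoE (f : A) :
  f = \sum_(m <- msupp f) f@_m *: mono (m 0%R) (m 1%R).
Proof. by rewrite {1}[f]mpolyE; apply: eq_bigr => m _; rewrite mpolyX_mono. Qed.

Notation grading := (@grading F q).

Lemma gradingM : {morph grading : f g / f * g}.
Proof. by move=> f g; rewrite grading.unlock rmorphM. Qed.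

Lemma gradingD : {morph grading : f g / f + g}.
Proof. by move=> f g; rewrite grading.unlock rmorphD. Qed.

Lemma gradingN : {morph grading : f / - f}.
Proof. by move=> f; rewrite grading.unlock rmorphN. Qed.

Lemma grading0 : grading 0 = 0.
Proof. by rewrite grading.unlock rmorph0. Qed.

Lemma grading_mono r s : grading (mono r s) = mono r s *: 'X^(wt r s).
Proof.
have gX i : grading 'X_i = 'X_i *: 'X^(if i == 0 then q else q.+1).
  by rewrite grading.unlock mmapX mmap1U.
have gXn f n : grading (f ^+ n) = grading f ^+ n by rewrite grading.unlock rmorphXn.
rewrite /mono gradingM !gXn !gX /= !exprZn -!exprM.
by rewrite -scalerAl -scalerAr scalerA -exprD /wt !(mulnC q, mulnC q.+1).
Qed.

Lemma gradingZ c f : grading (c *: f) = c%:MP *: grading f.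
Proof.
have gC : grading c%:MP = c%:MP%:P by rewrite grading.unlock mmapC.
by rewrite -mul_mpolyC gradingM gC mul_polyC.
Qed.

Lemma gradingE f : grading f =
  \sum_(m <- msupp f) (f@_m *: mono (m 0%R) (m 1%R)) *: 'X^(weight q m).
Proof.
rewrite {1}[f]monoE (big_morph _ gradingD grading0); apply: eq_bigr => m _.
by rewrite gradingZ grading_mono scalerA mul_mpolyC.
Qed.

(** The bound is strict, so that [below 0] means zero and inductions on the
    weight have a clean base case. *)
Definition below (n : nat) (f : A) : bool := (size (grading f) <= n)%N.

(** The sum of the coefficients of the monomials of weight n, obtained by
    evaluating the form of weight n at (1, 1). That point annihilates the
    leading form x^(q+1) - y^q of the Hermitian polynomial, and this is why
    [topcoef] descends to the coordinate ring of the curve. *)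
Definition topcoef (n : nat) (f : A) : F := ((grading f)`_n).@[fun=> 1].

Lemma coef_grading f k m :
  ((grading f)`_k)@_m = if weight q m == k then f@_m else 0.
Proof.
rewrite gradingE coef_sum raddf_sum /=.
have E m' : ((f@_m' *: mono (m' 0) (m' 1)) *: 'X^(weight q m'))`_k@_m =
    if m' == m then (if weight q m == k then f@_m else 0) else 0.
  rewrite coefZ coefXn -mpolyX_mono eq_sym.
  have [<-{m}|ne] := eqVneq m' m.
    by case: ifP => _; rewrite ?mulr0 ?mcoeff0 // mulr1 mcoeffZ mcoeffX eqxx mulr1.
  case: (_ == k); rewrite ?mulr0 ?mcoeff0 // mulr1 mcoeffZ mcoeffX.
  by rewrite (negPf ne) mulr0.
under eq_bigr do rewrite E.
rewrite -big_mkcond /=.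
have [mf|nmf] := boolP (m \in msupp f).
  by rewrite -big_filter (filter_pred1_uniq (msupp_uniq f) mf) big_seq1.
by rewrite (memN_msupp_eq0 nmf) if_same big1_seq.
Qed.

Lemma belowP n f :
  reflect {in msupp f, forall m, (weight q m < n)%N} (below n f).
Proof.
apply: (iffP idP) => [fn m mf | fn].
  rewrite ltnNge; apply/negP => nm; move: mf; rewrite mcoeff_msupp => /eqP [].
  have := coef_grading f (weight q m) m; rewrite eqxx => <-.
  by rewrite nth_default ?mcoeff0 // (leq_trans fn).
apply/leq_sizeP => k nk; apply/mpolyP => m; rewrite coef_grading mcoeff0.
case: eqP => // mk; apply/eqP; rewrite mcoeff_eq0.
by apply/negP => /fn; rewrite mk ltnNge nk.
Qed.

Lemma below0 n : below n 0. Proof. by rewrite /below grading0 size_poly0. Qed.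

Lemma below0P f : below 0 f -> f = 0.
Proof.
move/belowP => f0; apply/eqP; rewrite -msupp_eq0.
by case: (msupp f) f0 => // m s /(_ m (mem_head _ _)).
Qed.

Lemma belowW m n f : (m <= n)%N -> below m f -> below n f.
Proof. by move=> mn; rewrite /below => /leq_trans ->. Qed.

Lemma belowD n f g : below n f -> below n g -> below n (f + g).
Proof.
rewrite /below gradingD => fn gn.
by rewrite (leq_trans (size_polyD _ _)) // geq_max fn gn.
Qed.

Lemma belowN n f : below n (- f) = below n f.
Proof. by rewrite /below gradingN size_polyN. Qed.

Lemma belowB n f g : below n f -> below n g -> below n (f - g).
Proof. by move=> fn gn; rewrite belowD ?belowN. Qed.

Lemma belowM m n f g : below m.+1 f -> below n.+1 g -> below (m + n).+1 (f * g).
Proof.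
rewrite /below gradingM => fm gn; rewrite (leq_trans (size_polyMleq _ _)) //.
by have := leq_add fm gn; lia.
Qed.

Lemma below_mul_lt m n f g : below m f -> below n.+1 g -> below (m + n) (f * g).
Proof.
case: m => [/below0P ->|m]; first by rewrite mul0r below0.
by rewrite addSn; apply: belowM.
Qed.

Lemma belowZ n c f : below n f -> below n (c *: f).
Proof.
by rewrite /below gradingZ => fn; rewrite (leq_trans (size_scale_leq _ _)).
Qed.

Lemma below_mono n r s : below n (mono r s) = (wt r s < n)%N.
Proof.
rewrite /below grading_mono size_scale ?size_polyXn //.
by rewrite mono_mpolyX -msupp_eq0 msuppX.
Qed.

Lemma topcoefD n f g : topcoef n (f + g) = topcoef n f + topcoef n g.
Proof. by rewrite /topcoef gradingD coefD mevalD. Qed.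

Lemma topcoefN n f : topcoef n (- f) = - topcoef n f.
Proof. by rewrite /topcoef gradingN coefN mevalN. Qed.

Lemma topcoefB n f g : topcoef n (f - g) = topcoef n f - topcoef n g.
Proof. by rewrite topcoefD topcoefN. Qed.

Lemma topcoefZ n c f : topcoef n (c *: f) = c * topcoef n f.
Proof. by rewrite /topcoef gradingZ coefZ mevalM mevalC. Qed.

Lemma topcoef_below n f : below n f -> topcoef n f = 0.
Proof. by move=> fn; rewrite /topcoef nth_default ?meval0. Qed.

Lemma topcoef_mono n r s : topcoef n (mono r s) = (wt r s == n)%:R.
Proof.
rewrite /topcoef grading_mono coefZ coefXn eq_sym mevalM.
rewrite mevalM !rmorphXn /= !mevalXU !expr1n mul1r.
by case: (_ == _); rewrite ?meval1 ?meval0 mul1r.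
Qed.

Lemma topcoefM m n f g : below m.+1 f -> below n.+1 g ->
  topcoef (m + n) (f * g) = topcoef m f * topcoef n g.
Proof.
rewrite /below /topcoef gradingM => fm gn.
rewrite coefM -mevalM; congr (_.@[_]).
rewrite (bigD1 (Ordinal (leq_addr n m : (m < (m + n).+1)%N))) //=.
rewrite addKn big1 ?addr0 // => i ne_im.
have [im|mi] := ltnP i m.
  by rewrite [X in _ * X]nth_default ?mulr0 // (leq_trans gn) //; lia.
rewrite [X in X * _]nth_default ?mul0r // (leq_trans fm) // ltn_neqAle mi andbT.
by apply: contra ne_im => /eqP e; apply/eqP/val_inj.
Qed.

Hypothesis q_gt1 : (1 < q)%N.

Lemma hermitianE : H = mono q.+1 0 - mono 0 q - mono 0 1.
Proof. by rewrite /hermitian_poly /mono !expr0 !expr1 !mul1r mulr1. Qed.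

Lemma below_hermitian : below (q * q.+1).+1 H.
Proof. by rewrite hermitianE !belowB // below_mono /wt; nia. Qed.

Lemma topcoef_hermitian : topcoef (q * q.+1) H = 0.
Proof.
rewrite hermitianE !topcoefB !topcoef_mono /wt.
have -> : (q.+1 * q + 0 * q.+1 == q * q.+1)%N = true by nia.
have -> : (0 * q + q * q.+1 == q * q.+1)%N = true by nia.
have -> : (0 * q + 1 * q.+1 == q * q.+1)%N = false by nia.
by rewrite subr0 subrr.
Qed.

Lemma size_grading_hermitian : size (grading H) = (q * q.+1).+1.
Proof.
have := below_hermitian; rewrite {1}/below leq_eqVlt => /orP [/eqP //|lowH].
exfalso.
have /belowP /(_ (U_(0%R) *+ q.+1 + U_(1%R) *+ 0)%MM) : below (q * q.+1) H by [].
have E r s : weight q (U_(0%R) *+ r + U_(1%R) *+ s) = wt r s.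
  by rewrite /weight !mnmDE !mulmnE !mnm1E /= ?(muln0, muln1, mul1n, mul0n, addn0, add0n).
rewrite E mcoeff_msupp hermitianE !mcoeffB !mono_mpolyX !mcoeffX eqxx.
have N r : (U_(0%R) *+ 0 + U_(1%R) *+ r == U_(0%R) *+ q.+1 + U_(1%R) *+ 0 :> 'X_{1..2})%MM = false.
  apply/negP => /eqP/mnmP /(_ 0%R); rewrite !mnmDE !mulmnE !mnm1E /=; lia.
by rewrite !N !subr0 oner_eq0 /wt => /(_ isT); nia.
Qed.

(** Uniqueness of the order of a function on the curve: the leading form in t
    of u H is the product of those of u and H, and the latter vanishes at
    (1, 1). *)
Lemma topcoef_multiple n u : below n.+1 (u * H) -> topcoef n (u * H) = 0.
Proof.
move=> un; have [/topcoef_below //|nun] := boolP (below n (u * H)).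
have sz : size (grading (u * H)) = n.+1.
  by apply/eqP; rewrite eqn_leq; apply/andP; split=> //; rewrite ltnNge.
have : lead_coef (grading (u * H)) = lead_coef (grading u) * lead_coef (grading H).
  by rewrite gradingM lead_coefM.
rewrite {1 3}/lead_coef sz size_grading_hermitian /= {1}/topcoef => ->.
by rewrite mevalM [X in _ * X]topcoef_hermitian mulr0.
Qed.

(** * Congruence modulo H and lower weights *)

(** Equality of leading terms in the coordinate ring of the curve. *)
Definition congr_top (n : nat) (f g : A) : Prop :=
  exists u, below n (f - g - u * H).

Lemma congr_top_below n f g : below n (f - g) -> congr_top n f g.
Proof. by exists 0; rewrite mul0r subr0. Qed.

Lemma congr_top_sym n f g : congr_top n f g -> congr_top n g f.
Proof.
case=> u fg; exists (- u); rewrite -belowN.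
by have -> : - (g - f - - u * H) = f - g - u * H by ring.
Qed.

Lemma congr_top_trans n f g h :
  congr_top n f g -> congr_top n g h -> congr_top n f h.
Proof.
case=> u fg [v gh]; exists (u + v).
have -> : f - h - (u + v) * H = (f - g - u * H) + (g - h - v * H) by ring.
exact: belowD.
Qed.

Lemma congr_topD n f g f' g' :
  congr_top n f g -> congr_top n f' g' -> congr_top n (f + f') (g + g').
Proof.
case=> u fg [v fg']; exists (u + v).
have -> : f + f' - (g + g') - (u + v) * H
  = (f - g - u * H) + (f' - g' - v * H) by ring.
exact: belowD.
Qed.

Lemma congr_topZ n c f g : congr_top n f g -> congr_top n (c *: f) (c *: g).
Proof.
case=> u fg; exists (c *: u).
by rewrite -scalerAl -!scalerBr belowZ.
Qed.

(** Replacing y^q by x^(q+1) preserves the weight, and the term y that appears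
    has smaller weight because q > 1. *)
Lemma congr_top_shift r s k :
  congr_top (wt r (s + k * q)) (mono r (s + k * q)) (mono (r + k * q.+1) s).
Proof.
elim: k r s => [|k IH] r s.
  by rewrite !mul0n !addn0; apply: congr_top_below; rewrite subrr below0.
have E : wt r (s + k.+1 * q) = wt (r + q.+1) (s + k * q) by rewrite /wt; nia.
have := IH (r + q.+1)%N s; rewrite -E -addnA -mulSn; apply: congr_top_trans.
exists (- mono r (s + k * q)).
have -> : mono r (s + k.+1 * q) = mono r (s + k * q) * mono 0 q.
  by rewrite monoM addn0 mulSn -addnA (addnC q).
have -> : mono (r + q.+1) (s + k * q) = mono r (s + k * q) * mono q.+1 0.
  by rewrite monoM addn0.
have -> : mono r (s + k * q) * mono 0 q - mono r (s + k * q) * mono q.+1 0 -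
    - mono r (s + k * q) * H = - (mono r (s + k * q) * mono 0 1).
  by rewrite hermitianE; ring.
rewrite belowN monoM below_mono /wt; nia.
Qed.

Lemma congr_top_mono r s r' s' : wt r s = wt r' s' ->
  congr_top (wt r s) (mono r s) (mono r' s').
Proof.
wlog s's : r s r' s' / (s' <= s)%N => [th e|].
  have [le|/ltnW le] := leqP s' s; first exact: th.
  by rewrite e; apply/congr_top_sym/th.
rewrite /wt => e; pose k := ((r' - r) - (s - s'))%N.
have es : s = (s' + k * q)%N by rewrite /k; nia.
have er : r' = (r + k * q.+1)%N by rewrite /k; nia.
by clearbody k; rewrite er es -/(wt _ _); apply: congr_top_shift.
Qed.

(** Any monomial of the right weight represents the leading term. *)
Lemma congr_top_coef n r s f : wt r s = n -> below n.+1 f ->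
  congr_top n f (topcoef n f *: mono r s).
Proof.
move=> wn /belowP fn; rewrite {1 2}[f]monoE.
have -> : topcoef n (\sum_(m <- msupp f) f@_m *: mono (m 0) (m 1)) *: mono r s
    = \sum_(m <- msupp f) f@_m *: ((weight q m == n)%:R *: mono r s).
  rewrite (big_morph (topcoef n) (topcoefD n) (_ : _ = 0)); last first.
    exact/topcoef_below/below0.
  rewrite scaler_suml; apply: eq_bigr => m _.
  by rewrite topcoefZ topcoef_mono scalerA.
elim: (msupp f) fn => [_|m l IH fn]; first by
  rewrite !big_nil; apply: congr_top_below; rewrite subrr below0.
rewrite !big_cons; apply: congr_topD; last first.
  by apply: IH => m' m'l; rewrite fn // inE m'l orbT.
apply: congr_topZ; have := fn m (mem_head _ _); rewrite ltnS.
have [mn _|ne le] := eqVneq (weight q m) n.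
  by rewrite scale1r -{1}mn; apply: congr_top_mono; rewrite wn.
apply: congr_top_below; rewrite scale0r subr0 below_mono.
by rewrite ltn_neqAle ne.
Qed.

Lemma congr_top0 n f : below n.+1 f -> topcoef n f = 0 -> congr_top n f 0.
Proof.
move=> fn f0.
have [/hasP [m _ /eqP mn]|/hasPn nof] :=
  boolP (has (fun m => weight q m == n) (msupp f)).
  by have := congr_top_coef mn fn; rewrite f0 scale0r.
apply: congr_top_below; rewrite subr0; apply/belowP => m mf.
have := belowP _ _ fn m mf; rewrite ltnS leq_eqVlt => /orP [e|//].
by have := nof m mf; rewrite e.
Qed.

Lemma topcoef_prod k (B : {set F}) (f : F -> A) :
  (forall c, c \in B -> below k.+1 (f c)) ->
  below (#|B| * k).+1 (\prod_(c in B) f c) /\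
  topcoef (#|B| * k) (\prod_(c in B) f c) = \prod_(c in B) topcoef k (f c).
Proof.
move=> fk; rewrite -[X in below _ X]big_enum -[X in topcoef _ X]big_enum.
rewrite -[RHS]big_enum cardE /=.
have: {in enum B, forall c, below k.+1 (f c)} by move=> c; rewrite mem_enum => /fk.
elim: (enum B) => [|c r IH] rk.
  have -> : \prod_(c <- [::]) f c = mono 0 0 by rewrite big_nil /mono !expr0 mulr1.
  by rewrite below_mono topcoef_mono !big_nil.
have ck : below k.+1 (f c) by apply/rk/mem_head.
have [|IHb IHt] := IH; first by move=> d dr; apply: rk; rewrite inE dr orbT.
by rewrite !big_cons mulSn belowM // topcoefM // IHt.
Qed.

Definition vertical (c : F) : A := 'X_0 - c%:MP.
Definition horizontal (d : F) : A := 'X_1 - d%:MP.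

Lemma mpolyC_mono (c : F) : c%:MP = c *: mono 0 0.
Proof. by rewrite /mono !expr0 mulr1 -mul_mpolyC mulr1. Qed.

Lemma below_vertical c : below q.+1 (vertical c).
Proof.
rewrite /vertical mpolyC_mono; have -> : 'X_0 = mono 1 0 by rewrite /mono mulr1.
by rewrite belowB ?belowZ ?below_mono // /wt; lia.
Qed.

Lemma below_horizontal d : below q.+2 (horizontal d).
Proof.
rewrite /horizontal mpolyC_mono; have -> : 'X_1 = mono 0 1 by rewrite /mono mul1r.
by rewrite belowB ?belowZ ?below_mono // /wt; lia.
Qed.

Lemma topcoef_vertical c : topcoef q (vertical c) = 1.
Proof.
rewrite /vertical mpolyC_mono; have -> : 'X_0 = mono 1 0 by rewrite /mono mulr1.
rewrite topcoefB topcoefZ !topcoef_mono /wt !mul0n mul1n !addn0 eqxx.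
by case: (q) q_gt1 => // k _; rewrite mulr0 subr0.
Qed.

Lemma topcoef_horizontal d : topcoef q.+1 (horizontal d) = 1.
Proof.
rewrite /horizontal mpolyC_mono; have -> : 'X_1 = mono 0 1 by rewrite /mono mul1r.
by rewrite topcoefB topcoefZ !topcoef_mono /wt !mul0n mul1n !add0n eqxx mulr0 subr0.
Qed.

Definition subspace (P : A -> Prop) : Prop :=
  P 0 /\ forall c f g, P f -> P g -> P (c *: f + g).

Lemma subspace_sum P (I : eqType) (r : seq I) (c : I -> F) (f : I -> A) :
  subspace P -> {in r, forall i, P (f i)} -> P (\sum_(i <- r) c i *: f i).
Proof.
case=> P0 PD; elim: r => [|i r IH] Pr; first by rewrite big_nil.
rewrite big_cons; apply: PD; first exact/Pr/mem_head.
by apply: IH => j jr; apply: Pr; rewrite inE jr orbT.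
Qed.

(** The division algorithm in an abstract form: S plays the role of the normal
    forms, and a monomial only has to be reducible up to lower weight. It is
    used with J generated by two polynomials and S spanned by divisors of a
    weight, and with J the ideal of a set of points and S a weight bound. *)
Lemma division (J S : A -> Prop) : subspace J -> subspace S ->
  (forall r s, exists g h, [/\ S g, below (wt r s) h & J (mono r s - g - h)]) ->
  forall f, exists2 g, S g & J (f - g).
Proof.
move=> sJ sS red.
have sR : subspace (fun f => exists2 g, S g & J (f - g)).
  split; first by exists 0; rewrite ?subr0; [case: sS|case: sJ].
  move=> c f f' [g Sg Jg] [g' Sg' Jg']; exists (c *: g + g'); first exact: sS.2.
  have -> : c *: f + f' - (c *: g + g') = c *: (f - g) + (f' - g').
    by rewrite scalerBr; ring.
  exact: sJ.2.
have all_mono n r s : (wt r s < n)%N -> exists2 g, S g & J (mono r s - g).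
  elim: n r s => // n IH r s; rewrite ltnS => le.
  have [g [h [Sg /belowP hlow Jgh]]] := red r s.
  have [g' Sg' Jg'] : exists2 g', S g' & J (h - g').
    rewrite [h]monoE; apply: (subspace_sum _ sR) => m mh.
    by apply: IH; apply: leq_trans le; apply: hlow.
  exists (1 *: g + g'); first exact: sS.2.
  have -> : mono r s - (1 *: g + g') = 1 *: (mono r s - g - h) + (h - g').
    by rewrite !scale1r; ring.
  exact: sJ.2.
move=> f; rewrite [f]monoE; apply: (subspace_sum _ sR) => m _.
exact: all_mono (ltnSn _).
Qed.

End Grading.

(** * Trace and norm fibres, and sums over the points of the curve *)

Section Counting.
Set Implicit Arguments.
Unset Strict Implicit.
Unset Printing Implicit Defensive.
Import GRing.Theory.
Local Open Scope ring_scope.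

(** Pigeonhole with equality. It turns upper bounds for the fibres of the trace
    and of the norm, which come from counting roots, into exact
    cardinalities. *)
Lemma sum_nat_tight (I : finType) (L : {set I}) (f : I -> nat) (a b : nat) :
  (0 < b)%N -> {in L, forall t, (f t <= b)%N} -> (#|L| <= a)%N ->
  (\sum_(t in L) f t = a * b)%N -> #|L| = a /\ {in L, forall t, f t = b}.
Proof.
move=> b_gt0 fb La sumf.
have sumd : (\sum_(t in L) f t + \sum_(t in L) (b - f t) = #|L| * b)%N.
  rewrite -big_split /= -sum_nat_const; apply: eq_bigr => t tL.
  by rewrite subnKC // fb.
have /eqP : (\sum_(t in L) (b - f t) = 0)%N by nia.
have eqL : #|L| = a by nia.
rewrite sum_nat_eq0 => /forall_inP df; split=> // t tL.
by have := fb t tL; have := df t tL; lia.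
Qed.

Lemma subset_of_card (T : finType) (A : {set T}) k : (k <= #|A|)%N ->
  exists2 B : {set T}, B \subset A & #|B| = k.
Proof.
move=> kA; exists [set x in take k (enum A)].
  by apply/subsetP => x; rewrite inE => /mem_take; rewrite mem_enum.
rewrite cardsE (card_uniqP _) ?take_uniq ?enum_uniq //.
by rewrite size_take_min -cardE; apply/minn_idPl.
Qed.

Variable F : finFieldType.

Lemma card_root_set (P : {poly F}) : P != 0 -> (#|[set x | root P x]| < size P)%N.
Proof.
move=> P0; rewrite cardE; apply: max_poly_roots => //; last exact: enum_uniq.
by apply/allP => x; rewrite mem_enum inE.
Qed.

Lemma exists_expr_neq1 (B : {set F}) j : (0 < j)%N -> (j < #|B|)%N ->
  exists2 c, c \in B & c ^+ j != 1.
Proof.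
move=> j0 jB; apply/exists_inP; apply: contraLR jB => /exists_inPn all1.
rewrite -leqNgt -ltnS -(size_XnsubC (1 : F) j0).
apply: leq_ltn_trans (card_root_set _); last first.
  by rewrite -size_poly_eq0 size_XnsubC.
apply/subset_leq_card/subsetP => c /all1; rewrite negbK inE => /eqP c1.
by rewrite /root !hornerE c1 subrr.
Qed.

(** Multiplication by c permutes U and multiplies the sum by c^j. *)
Lemma power_sum_scale (U : {set F}) (c : F) j : c != 0 ->
  (forall u, (c * u \in U) = (u \in U)) -> c ^+ j != 1 ->
  \sum_(u in U) u ^+ j = 0.
Proof.
move=> c0 cU cj.
have E : \sum_(u in U) u ^+ j = c ^+ j * \sum_(u in U) u ^+ j.
  rewrite mulr_sumr (reindex_inj (mulfI c0)) /=.
  by apply: eq_big => [u|u _]; rewrite ?cU ?exprMn.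
apply/eqP; have /eqP : (1 - c ^+ j) * (\sum_(u in U) u ^+ j) = 0.
  by rewrite mulrBl mul1r -E subrr.
by rewrite mulf_eq0 subr_eq0 eq_sym (negPf cj).
Qed.

Variables (p e q : nat) (p_prime : prime p) (e_gt0 : (0 < e)%N).
Hypotheses (q_def : q = (p ^ e)%N) (card_F : #|F| = (q ^ 2)%N).

Lemma q_gt1 : (1 < q)%N.
Proof. by rewrite q_def -(exp1n e) ltn_exp2r ?prime_gt1. Qed.

Let q1 := q_gt1.

Lemma pchar_p : p \in [pchar F].
Proof. by apply: (@card_finPcharP F p (e * 2)); rewrite // expnM -q_def. Qed.

Lemma natr_q : q%:R = 0 :> F.
Proof.
by apply/eqP; rewrite -(dvdn_pcharf pchar_p) q_def dvdn_exp.
Qed.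

Lemma frobD (x y : F) : (x + y) ^+ q = x ^+ q + y ^+ q.
Proof.
apply: exprDn_pchar; rewrite q_def pnatX; apply/orP; left.
by rewrite pnatE // pchar_p.
Qed.

Lemma expr_qq (x : F) : x ^+ (q ^ 2) = x.
Proof. by rewrite -card_F expf_card. Qed.

Definition frob_fixed : {set F} := [set t | t ^+ q == t].

Definition trace_fibre (t : F) : {set F} := [set y | y ^+ q + y == t].

Definition norm_fibre (t : F) : {set F} := [set x | x ^+ q.+1 == t].

Lemma trace_fixed y : y ^+ q + y \in frob_fixed.
Proof. by rewrite inE frobD -exprM mulnn expr_qq addrC. Qed.

Lemma norm_fixed x : x ^+ q.+1 \in frob_fixed.
Proof. by rewrite inE -exprM mulSn exprD mulnn expr_qq -exprSr. Qed.

Lemma card_frob_fixed_le : (#|frob_fixed| <= q)%N.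
Proof.
have sz : size ('X^q - 'X : {poly F}) = q.+1.
  by rewrite size_polyDl ?size_polyXn // size_polyN size_polyX.
rewrite -ltnS -sz; apply: leq_ltn_trans (card_root_set _); last first.
  by rewrite -size_poly_eq0 sz.
apply/subset_leq_card/subsetP => t; rewrite !inE => /eqP tq.
by rewrite /root !hornerE tq subrr.
Qed.

Lemma card_trace_fibre_le t : (#|trace_fibre t| <= q)%N.
Proof.
have sz : size ('X^q + ('X - t%:P) : {poly F}) = q.+1.
  by rewrite size_polyDl ?size_polyXn // size_XsubC.
rewrite -ltnS -sz; apply: leq_ltn_trans (card_root_set _); last first.
  by rewrite -size_poly_eq0 sz.
apply/subset_leq_card/subsetP => y; rewrite !inE => /eqP yt.
by rewrite rootE hornerD hornerXn hornerXsubC addrA yt subrr.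
Qed.

Lemma trace_count : #|frob_fixed| = q /\
  {in frob_fixed, forall t, #|trace_fibre t| = q}.
Proof.
apply: sum_nat_tight card_frob_fixed_le _ => //.
- exact: ltnW.
- by move=> t _; apply: card_trace_fibre_le.
rewrite mulnn -card_F -sum1_card [RHS](partition_big (fun y => y ^+ q + y) (mem frob_fixed)) /=.
   by apply: eq_bigr => t _; rewrite sum1dep_card.
by move=> y _; apply: trace_fixed.
Qed.

Lemma card_norm_fibre_le t : (#|norm_fibre t| <= q.+1)%N.
Proof.
have sz : size ('X^(q.+1) - t%:P : {poly F}) = q.+2 by rewrite size_XnsubC.
rewrite -ltnS -sz; apply: leq_ltn_trans (card_root_set _); last first.
  by rewrite -size_poly_eq0 sz.
apply/subset_leq_card/subsetP => y; rewrite !inE => /eqP yt.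
by rewrite /root !hornerE yt subrr.
Qed.

Lemma card_norm_fibre1 : #|norm_fibre 1| = q.+1.
Proof.
have L0 : 0 \in frob_fixed by rewrite inE expr0n; case: (q) q1.
have cL : #|frob_fixed :\ 0| = q.-1.
  by have := cardsD1 0 frob_fixed; rewrite L0 trace_count.1 => ->.
(* The q^2 - 1 nonzero elements are distributed over the q - 1 possible norms. *)
have [_ ->] // : #|frob_fixed :\ 0| = q.-1 /\
  {in frob_fixed :\ 0, forall t, #|norm_fibre t| = q.+1}.
- apply: sum_nat_tight => //; first by move=> t _; apply: card_norm_fibre_le.
    by rewrite cL.
  have -> : (q.-1 * q.+1 = #|[set~ (0%R : F)]|)%N.
    by rewrite cardsC1 card_F; have := q1; nia.
  rewrite -sum1_card [RHS](partition_big (fun y => y ^+ q.+1) (mem (frob_fixed :\ 0))) /=.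
    apply: eq_bigr => t; rewrite in_setD1 => /andP[t0 _].
    rewrite sum1dep_card; congr #|pred_of_set _|; apply/setP => x; rewrite !inE.
    case: eqP => [xt|_]; rewrite ?andbF // andbT.
    by move: t0; rewrite -xt expf_eq0 /= => ->.
  move=> x; rewrite !inE => x0; rewrite expf_eq0 /= x0 /=.
  by have := norm_fixed x; rewrite inE.
by rewrite !inE oner_eq0 expr1n eqxx.
Qed.

(** The kernel of the trace is stable under scaling by the q - 1 nonzero
    elements fixed by the Frobenius, and some such c has c^j <> 1 when
    0 < j < q - 1. *)
Lemma power_sum_kernel j : (j < q.-1)%N -> \sum_(k in trace_fibre 0) k ^+ j = 0.
Proof.
case: j => [_|j jq].
  under eq_bigr do rewrite expr0.
  rewrite sumr_const trace_count.2 ?natr_q // inE expr0n; by case: (q) q1.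
have L0 : 0 \in frob_fixed by rewrite inE expr0n; case: (q) q1.
have cL : #|frob_fixed :\ 0| = q.-1.
  by have := cardsD1 0 frob_fixed; rewrite L0 trace_count.1 => ->.
have [//|c] := @exists_expr_neq1 (frob_fixed :\ 0) j.+1 isT; first by rewrite cL.
rewrite !inE => /andP [c0 /eqP cq] cj.
apply: (power_sum_scale c0 _ cj) => u; rewrite !inE exprMn cq -mulrDr mulf_eq0.
by rewrite (negPf c0).
Qed.

(** A trace fibre is a translate y0 + K of the kernel K. Expanding
    (y0 + k)^s, the power sums of K of exponent below q - 1 vanish, and only
    the term k^s can survive. *)
Lemma power_sum_fibre t s : t \in frob_fixed -> (s < q)%N ->
  \sum_(y in trace_fibre t) y ^+ s = \sum_(k in trace_fibre 0) k ^+ s.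
Proof.
move=> tL sq; have : (0 < #|trace_fibre t|)%N by rewrite trace_count.2 // ltnW.
move=> /card_gt0P [y0]; rewrite inE => /eqP y0t.
rewrite (reindex_inj (addrI y0)) /=.
rewrite (eq_bigl (mem (trace_fibre 0))); last first.
  move=> k; rewrite !inE frobD addrACA y0t -subr_eq0 addrAC subrr add0r //.
under eq_bigr do rewrite exprDn.
rewrite exchange_big /= big_ord_recr /= [X in X + _]big1 ?add0r.
  by apply: eq_bigr => k _; rewrite subnn expr0 mul1r binn.
move=> i _; under eq_bigr do rewrite -mulrnAl.
by rewrite -mulr_sumr power_sum_kernel ?mulr0 //; have := ltn_ord i; lia.
Qed.

Lemma power_sum_field r : (r < (q ^ 2).-1)%N -> \sum_(x : F) x ^+ r = 0.
Proof.
case: r => [_|r rq].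
  under eq_bigr do rewrite expr0.
  by rewrite sumr_const card_F natrX natr_q expr0n.
have [//|c] := @exists_expr_neq1 [set~ 0] r.+1 isT; first by rewrite cardsC1 card_F.
rewrite !inE => c0 cj; rewrite -[RHS](power_sum_scale (U := setT) c0 _ cj).
  by apply: eq_bigl => u; rewrite inE.
by move=> u; rewrite !inE.
Qed.

Notation A := {mpoly F[2]}.
Notation H := (hermitian_poly F q).
Notation E := (hermitian_points F q).

Definition pt (x y : F) : point F := [ffun i => if i == 0 then x else y].

Lemma pt_eta (P : point F) : pt (P 0) (P 1) = P.
Proof.
apply/ffunP => i; rewrite ffunE.
by case: i => [[|[|//]] lt] /=; congr (P _); apply: val_inj.
Qed.

Lemma meval_mono x y r s : (mono F r s).@[pt x y] = x ^+ r * y ^+ s.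
Proof. by rewrite mevalM !rmorphXn /= !mevalXU !ffunE. Qed.

Lemma mem_pt x y : (pt x y \in E) = (y ^+ q + y == x ^+ q.+1).
Proof.
rewrite inE hermitianE !mevalB !meval_mono !expr0 !expr1 mulr1 !mul1r.
by rewrite -addrA -opprD subr_eq0 eq_sym.
Qed.

Lemma meval_hermitian P : P \in E -> H.@[P] = 0.
Proof. by rewrite inE => /eqP. Qed.

Lemma sum_points (R : nmodType) (f : point F -> R) :
  \sum_(P in E) f P =
  \sum_(x : F) \sum_(y in trace_fibre (x ^+ q.+1)) f (pt x y).
Proof.
rewrite pair_big_dep /= (reindex (fun u => pt u.1 u.2)) /=.
  by apply: eq_bigl => -[x y]; rewrite mem_pt inE.
exists (fun P => (P 0, P 1)) => [[x y] _|P _]; last exact: pt_eta.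
by rewrite !ffunE.
Qed.

(** Reduce to s < q by y^q = x^(q+1) - y on the curve. For s < q - 1 the sum
    over each vertical line vanishes; for s = q - 1 it does not depend on the
    line, and the bound on the weight gives r < q^2 - 1, so that the sum of the
    x^r over the field vanishes. *)
Lemma sum_points_mono r s : (wt q r s < q ^ 3 + q ^ 2 - q - 1)%N ->
  \sum_(P in E) (mono F r s).@[P] = 0.
Proof.
have [n] := ubnP s; elim: n r s => // n IH r s sn lt.
have [sq|qs] := ltnP s q.
  rewrite sum_points.
  transitivity (\sum_x x ^+ r * \sum_(k in trace_fibre 0) k ^+ s).
    apply: eq_bigr => x _; rewrite -(power_sum_fibre (norm_fixed x) sq) mulr_sumr.
    by apply: eq_bigr => y _; rewrite meval_mono.
  have [sq1|q1s] := ltnP s q.-1.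
    by apply: big1 => x _; rewrite power_sum_kernel ?mulr0.
  rewrite -mulr_suml power_sum_field ?mul0r //.
  have es : s = q.-1 by lia.
  by move: lt; rewrite es /wt; nia.
transitivity (\sum_(P in E) ((mono F (r + q.+1) (s - q)).@[P]
    - (mono F r (s - q).+1).@[P])).
  apply: eq_bigr => P; rewrite -(pt_eta P) mem_pt !meval_mono => /eqP tn.
  rewrite exprD -tn -{1}(subnK qs) exprD exprS; ring.
rewrite sumrB !IH ?subr0 //; [lia| |lia|]; apply: leq_ltn_trans lt; rewrite /wt; nia.
Qed.

Lemma sum_points_below f : below q (q ^ 3 + q ^ 2 - q - 1) f ->
  \sum_(P in E) f.@[P] = 0.
Proof.
move/belowP => flow; rewrite [f]monoE.
under eq_bigr do rewrite raddf_sum.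
rewrite exchange_big /= big_seq big1 // => m /flow mlow.
under eq_bigr do rewrite mevalZ.
by rewrite -mulr_sumr sum_points_mono ?mulr0.
Qed.

End Counting.

(** * Hermitian codes and explicit codewords *)

Section Codes.
Set Implicit Arguments.
Unset Strict Implicit.
Unset Printing Implicit Defensive.
Import GRing.Theory.
Local Open Scope ring_scope.

Lemma distance_le (F : finFieldType) n (C : {set 'rV[F]_n}) (c : 'rV[F]_n) :
  c \in C -> c != 0 -> (distance C <= hamming_weight c)%N.
Proof.
move=> cC c0; rewrite /distance; have := mem_index_enum c.
elim: (index_enum _) => // d r IH; rewrite big_cons inE.
case/predU1P => [<-|/IH le]; first by rewrite cC c0 geq_minl.
by case: ifP => _ //; rewrite geq_min le orbT.
Qed.

Lemma distance_ge (F : finFieldType) n (C : {set 'rV[F]_n}) d : (d <= n)%N ->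
  (forall c, c \in C -> c != 0 -> (d <= hamming_weight c)%N) ->
  (d <= distance C)%N.
Proof.
move=> dn dC; apply: (big_ind (fun x => (d <= x)%N)) => //.
  by move=> x y dx dy; rewrite leq_min dx.
by move=> c /andP [cC c0]; apply: dC.
Qed.

Lemma hamming_weight_eq0 (F : finFieldType) n (c : 'rV[F]_n) :
  (hamming_weight c == 0%N) = (c == 0).
Proof.
apply/idP/eqP => [|->]; last first.
  by rewrite cards_eq0; apply/eqP/setP => i; rewrite !inE mxE eqxx.
rewrite cards_eq0 => /eqP/setP c0; apply/rowP => i; rewrite mxE.
by apply/eqP; have := c0 i; rewrite !inE => /negbFE.
Qed.

Variables (F : finFieldType) (p e q : nat) (p_prime : prime p) (e_gt0 : (0 < e)%N).
Hypotheses (q_def : q = (p ^ e)%N) (card_F : #|F| = (q ^ 2)%N).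
Notation A := {mpoly F[2]}.
Notation H := (hermitian_poly F q).
Notation E := (hermitian_points F q).

Let q1 : (1 < q)%N := q_gt1 p_prime e_gt0 q_def.

(** The number of elements of the weight semigroup that divide the weight of
    x^a y^b, for b < q; the second summand vanishes for a <= q by truncated
    subtraction, and otherwise comes from y^q having the weight of x^(q+1). *)
Definition nu (a b : nat) : nat := (a.+1 * b.+1 + (a - q) * (q.-1 - b))%N.

Lemma ideal_generated2 (R : comNzRingType) (f g h : R) :
  ideal_generated [:: f; g] h <-> exists u v, h = u * f + v * g.
Proof.
split=> [[a ->]|[u [v ->]]].
  by exists (a ord0), (a (lift ord0 ord0)); rewrite !big_ord_recl big_ord0 addr0.
exists (fun i => if i == ord0 then u else v).
by rewrite !big_ord_recl big_ord0 addr0.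
Qed.

Lemma hermitian_ideal_vanishing f P : hermitian_ideal q f -> P \in E -> f.@[P] = 0.
Proof.
have fieldeq i : ('X_i ^+ (q ^ 2)%N - 'X_i : A).@[P] = 0.
  by rewrite mevalB rmorphXn /= mevalXU expr_qq ?subrr.
case=> a -> PE; rewrite !big_ord_recl big_ord0 addr0 /= !mevalD !mevalM.
by rewrite !fieldeq meval_hermitian // !mulr0 !addr0.
Qed.

Lemma mem_hermitian_code m (c : 'rV[F]_#|E|) :
  c \in hermitian_code F q m <->
  forall g, below q m.+1 g -> \sum_i c 0 i * g.@[hermitian_point i] = 0.
Proof.
split=> [|cg]; rewrite inE.
  move=> /asboolP cV g /belowP gm; have := cV (hermitian_eval q g).
  under eq_bigr do rewrite mxE.
  apply; exists g => //; exists g => [mon /gm //|]; exists (fun=> 0).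
  by rewrite subrr big1 // => i _; rewrite mul0r.
apply/asboolP => v [f [g gm fg] ->].
rewrite -[RHS](cg g); last by apply/belowP => mon /gm.
apply: eq_bigr => i _; rewrite mxE; congr (_ * _); apply/eqP.
rewrite -subr_eq0 -mevalB; apply/eqP.
exact: hermitian_ideal_vanishing fg (enum_valP i).
Qed.

Lemma hermitian_code_sub m m' : (m' <= m)%N ->
  hermitian_code F q m \subset hermitian_code F q m'.
Proof.
move=> le; apply/subsetP => c /mem_hermitian_code cm.
apply/mem_hermitian_code => g gm'; apply: cm; exact: belowW gm'.
Qed.

(** Self-duality of Hermitian codes: the pairing of the evaluations of f and g
    is the sum of f g over the curve. *)
Lemma hermitian_eval_code m k f : below q k.+1 f ->
  (k + m < q ^ 3 + q ^ 2 - q - 1)%N -> hermitian_eval q f \in hermitian_code F q m.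
Proof.
move=> fk km; apply/mem_hermitian_code => g gm.
rewrite -[RHS](@sum_points_below F p e q p_prime e_gt0 q_def card_F (f * g)).
  rewrite [RHS]big_enum_val; apply: eq_bigr => i _; rewrite mxE mevalM //.
exact: belowW km (belowM fk gm).
Qed.

Lemma mem_codeword_support (c : 'rV[F]_#|E|) P : P \in codeword_support c ->
  exists2 i, P = hermitian_point i & c 0 i != 0.
Proof. by case/imsetP => i; rewrite inE; exists i. Qed.

Lemma codeword_support_point (c : 'rV[F]_#|E|) P : P \in codeword_support c -> P \in E.
Proof. by case/mem_codeword_support => i -> _; apply: enum_valP. Qed.

Lemma card_codeword_support (c : 'rV[F]_#|E|) :
  #|codeword_support c| = hamming_weight c.
Proof. by rewrite card_imset //; apply: enum_val_inj. Qed.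

Lemma codeword_support_eval f :
  codeword_support (hermitian_eval q f) = [set P in E | f.@[P] != 0].
Proof.
apply/setP => P; rewrite !inE; apply/idP/idP.
  case/mem_codeword_support => i ->; rewrite mxE => ->.
  by have := enum_valP i; rewrite inE => ->.
move=> /andP [PE fP]; apply/imsetP; have PE' : P \in E by rewrite inE.
exists (enum_rank_in PE' P); last by rewrite /hermitian_point enum_rankK_in.
by rewrite inE mxE /hermitian_point enum_rankK_in.
Qed.

Lemma meval_prod_neq0 (B : {set F}) (i : 'I_2) P :
  ((\prod_(c in B) ('X_i - c%:MP)).@[P] != 0) = (P i \notin B).
Proof.
rewrite rmorph_prod /=; apply/prodf_neq0/idP => [nz|nB c cB].
  by apply/negP => /nz; rewrite mevalB mevalXU mevalC subrr eqxx.
by rewrite mevalB mevalXU mevalC subr_eq0; apply: contraNneq nB => ->.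
Qed.

(** Comparing the set of abscissas with the elements of norm 1 is what makes the
    vertical lines and the horizontal lines y = d with d of trace 1 meet in a
    controlled way. *)
Lemma exists_abscissas a : (a < q ^ 2)%N -> exists2 S : {set F}, #|S| = a.+1 &
  (if (a <= q)%N then S \subset norm_fibre q 1 else norm_fibre q 1 \subset S).
Proof.
move=> aq; have cN : #|norm_fibre q (1 : F)| = q.+1 by exact: card_norm_fibre1 q_def card_F.
case: leqP => [le|gt].
  by have [|S SN cS] := @subset_of_card F (norm_fibre q 1) a.+1; [rewrite cN|exists S].
have cC : #|~: norm_fibre q (1 : F)| = (q ^ 2 - q.+1)%N.
  by have := cardsC (norm_fibre q (1 : F)); rewrite cN card_F; lia.
have [|S SN cS] := @subset_of_card F (~: norm_fibre q 1) (a - q); first by rewrite cC; lia.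
exists (norm_fibre q 1 :|: S); last exact: subsetUl.
rewrite cardsU cN cS (_ : _ :&: S = set0) ?cards0; first by lia.
apply/setP => x; rewrite in_setI in_set0; apply/negP => /andP [xN /(subsetP SN)].
by rewrite in_setC xN.
Qed.

(** A vertical line over an element of norm 1 carries exactly the points whose
    ordinates have trace 1, of which T survive; over other abscissas all q
    points survive. *)
Lemma card_codeword_points a (S T : {set F}) : #|S| = a.+1 ->
  T \subset trace_fibre q 1 -> (0 < #|T|)%N ->
  (if (a <= q)%N then S \subset norm_fibre q 1 else norm_fibre q 1 \subset S) ->
  #|[set P in E | (P 0 \in S) && (P 1 \notin trace_fibre q 1 :\: T)]| = nu a #|T|.-1.
Proof.
move=> cS TT T0 SN.
have cN : #|norm_fibre q (1 : F)| = q.+1 by exact: card_norm_fibre1 q_def card_F.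
have [_ cT] := trace_count p_prime e_gt0 q_def card_F.
have TT1 : (#|T| <= q)%N.
  by rewrite -(cT 1) ?subset_leq_card // inE expr1n.
rewrite -sum1_card.
rewrite (eq_bigl (fun P => (P \in E) && ((P 0 \in S) && (P 1 \notin trace_fibre q 1 :\: T)))); last first.
  by move=> P; rewrite !inE.
rewrite big_mkcondr /= sum_points /=.
transitivity (\sum_(x in S) if x \in norm_fibre q 1%R then #|T| else q)%N.
  rewrite [RHS]big_mkcond /=; apply: eq_bigr => x _.
  rewrite -big_mkcondr /=.
  case: ifPn => xS; last first.
    by rewrite big_pred0 // => y; rewrite !ffunE /= (negPf xS) andbF.
  case: ifPn => xN.
    rewrite -[RHS]sum1_card; apply: eq_bigl => y; rewrite !ffunE /= xS /=.
    move: xN; rewrite inE => /eqP ->; rewrite in_setD negb_and negbK.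
    have [yT|] := boolP (y \in T); first by rewrite (subsetP TT).
    by rewrite andbN.
  rewrite -[RHS](cT _ (norm_fixed card_F x)) -sum1_card.
  apply: eq_bigl => y; rewrite !ffunE /= xS /= !inE negb_and negbK.
  have [yx|//] := eqVneq (y ^+ q + y) (x ^+ q.+1).
  by move: xN; rewrite inE yx => /negPf ->; rewrite orbT.
rewrite (big_setID (norm_fibre q 1)) /=.
rewrite (eq_bigr (fun=> #|T|)) => [|x]; last by rewrite inE => /andP [_ ->].
rewrite [X in (_ + X)%N](eq_bigr (fun=> q)) => [|x]; last by rewrite inE => /andP [/negPf ->].
rewrite !sum_nat_const /nu.
have cI := cardsID (norm_fibre q 1) S.
case: leqP SN => [le SN|gt NS].
  have cI' : #|S :&: norm_fibre q 1| = a.+1 by rewrite (setIidPl SN).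
  have -> : #|S :\: norm_fibre q 1| = 0%N by lia.
  have -> : (a - q = 0)%N by lia.
  by rewrite cI' prednK // addn0.
have cI' : #|S :&: norm_fibre q 1| = q.+1 by rewrite (setIidPr NS).
have -> : #|S :\: norm_fibre q 1| = (a - q)%N by lia.
have -> : (q.-1 - #|T|.-1 = q - #|T|)%N by lia.
rewrite cI' prednK //.
have -> : (a.+1 = (a - q) + q.+1)%N by lia.
have -> : ((a - q) * q = (a - q) * #|T| + (a - q) * (q - #|T|))%N.
  by rewrite -mulnDr subnKC.
by rewrite mulnDl addnA (addnC (q.+1 * _)%N).
Qed.

(** The bound nu is attained. The word consists of the values of the product of
    the lines x = c for c outside S and y = d for d of trace 1 outside T; the
    weights of this product and of x^a y^b add up to the weight of
    x^(q^2-1) y^(q-1), which is the first weight with nonzero sum over the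
    curve. For a <= q the support lies in the grid S x T. *)
Lemma exists_codeword a b m : (a < q ^ 2)%N -> (b < q)%N -> (m < wt q a b)%N ->
  exists c (S T : {set F}),
  [/\ c \in hermitian_code F q m, hamming_weight c = nu a b,
      #|S| = a.+1, #|T| = b.+1
    & (a <= q)%N -> {in codeword_support c, forall P : point F, P 0 \in S /\ P 1 \in T}].
Proof.
move=> aq bq mlt; have [S cS SN] := exists_abscissas aq.
have [_ cT] := trace_count p_prime e_gt0 q_def card_F.
have cT1 : #|trace_fibre q (1 : F)| = q by rewrite cT // inE expr1n.
have [|T TT cardT] := @subset_of_card F (trace_fibre q 1) b.+1; first by rewrite cT1.
(* The number of lines: q^2 - (a + 1) vertical and q - (b + 1) horizontal. *)
pose f := \prod_(c in ~: S) vertical c * \prod_(d in trace_fibre q 1 :\: T) horizontal d.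
have supp : codeword_support (hermitian_eval q f) =
    [set P in E | (P 0 \in S) && (P 1 \notin trace_fibre q 1 :\: T)].
  rewrite codeword_support_eval; apply/setP => P; rewrite [LHS]in_set [RHS]in_set.
  by congr (_ && _); rewrite mevalM mulf_eq0 negb_or !meval_prod_neq0 in_setC negbK.
exists (hermitian_eval q f), S, T; split=> //.
- have cD : #|trace_fibre q 1 :\: T| = (q - b.+1)%N.
    by rewrite cardsD cT1 (setIidPr TT) cardT.
  have cC : #|~: S| = (q ^ 2 - a.+1)%N by have := cardsC S; rewrite cS card_F; lia.
  have fk : below q ((q ^ 2 - a.+1) * q + (q - b.+1) * q.+1).+1 f.
    rewrite -cD -cC; apply: belowM.
      by case: (@topcoef_prod F q q (~: S) (@vertical F)) => // c _; apply: below_vertical.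
    case: (@topcoef_prod F q q.+1 (trace_fibre q 1 :\: T) (@horizontal F)) => // c _.
    exact: below_horizontal.
  apply: (hermitian_eval_code fk); move: mlt; rewrite /wt.
  have e1 : ((q ^ 2 - a.+1 + a).+1 * q = q ^ 3)%N by rewrite -addnS subnK // -expnSr.
  have e2 : ((q - b.+1 + b).+1 * q.+1 = q ^ 2 + q)%N by rewrite -addnS subnK // mulnS -mulnn addnC.
  move: e1 e2; clear; move: (q ^ 3)%N (q ^ 2)%N (q - b.+1)%N => q3 q2 B.
  move: (q2 - a.+1)%N => S; nia.
- rewrite -card_codeword_support supp (card_codeword_points cS) ?cardT //.
move=> le P; rewrite supp in_set => /and3P [PE PS PT]; split=> //.
move: PT; rewrite in_setD negb_and negbK => /orP [//|].
move: SN PE; rewrite le -(pt_eta P) mem_pt !ffunE /= => SN /eqP yx.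
by rewrite inE yx; have := subsetP SN _ PS; rewrite inE => ->.
Qed.

End Codes.

(** * Leading weights modulo the Hermitian polynomial *)

Section Footprint.
Set Implicit Arguments.
Unset Strict Implicit.
Unset Printing Implicit Defensive.
Import GRing.Theory.
Local Open Scope ring_scope.

Variables (F : finFieldType) (q : nat).
Hypothesis (q_gt1 : (1 < q)%N).
Notation A := {mpoly F[2]}.
Notation H := (hermitian_poly F q).
Notation E := (hermitian_points F q).

Lemma topcoefE n (f : A) :
  topcoef q n f = \sum_(m <- msupp f | weight q m == n) f@_m.
Proof.
rewrite {1}[f]monoE (big_morph _ (topcoefD q n) (topcoef_below (below0 F q n))).
rewrite [RHS]big_mkcond; apply: eq_bigr => m _.
by rewrite topcoefZ topcoef_mono /wt /weight; case: (_ == _); rewrite ?mulr1 ?mulr0.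
Qed.

Lemma topcoef_neq0 n (f : A) : topcoef q n f != 0 -> exists r s, n = wt q r s.
Proof.
rewrite topcoefE; have [/hasP [m _ /eqP <-] _|/hasPn no] :=
  boolP (has (fun m => weight q m == n) (msupp f)); first by exists (m 0%R), (m 1%R).
rewrite big_seq_cond big1 ?eqxx // => m /andP [mf].
by rewrite (negPf (no m mf)).
Qed.

(** A nonzero element of the coordinate ring of the curve has an order. *)
Lemma reduce_hermitian (f : A) : (exists u, f = u * H) \/
  exists k u, below q k.+1 (f - u * H) /\ topcoef q k (f - u * H) != 0.
Proof.
have [n] : exists n, below q n f by exists (size (@grading F q f)); apply: leqnn.
elim: n f => [|n IH] f fn; first by left; exists 0; rewrite mul0r (below0P fn).
have [f0|f0] := eqVneq (topcoef q n f) 0; last first.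
  by right; exists n, 0; rewrite mul0r subr0.
have [u] := congr_top0 q_gt1 fn f0; rewrite subr0 => /IH [[v fv]|[k [v [fk fv]]]].
  by left; exists (u + v); rewrite mulrDl -fv; ring.
right; exists k, (u + v); move: fk fv.
by have -> : f - (u + v) * H = f - u * H - v * H by ring.
Qed.

Lemma order_unique k l (f g u : A) : below q k.+1 f -> topcoef q k f != 0 ->
  below q l.+1 g -> topcoef q l g != 0 -> f - g = u * H -> k = l.
Proof.
wlog kl : k l f g u / (k <= l)%N => [th fk f0 gl g0 fg|].
  have [le|/ltnW le] := leqP k l; first exact: th fk f0 gl g0 fg.
  apply/esym; apply: (th l k g f (- u) le gl g0 fk f0).
  by rewrite mulNr -fg opprB.
move=> fk f0 gl g0 fg; apply/eqP; rewrite eqn_leq kl leqNgt; apply/negP => lt.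
have fgl : below q l.+1 (u * H) by rewrite -fg belowB // (belowW _ fk) // ltnS ltnW.
have := topcoef_multiple q_gt1 fgl; rewrite -fg topcoefB (topcoef_below (belowW lt fk)).
by rewrite sub0r => /eqP; rewrite oppr_eq0 (negPf g0).
Qed.

(** q + 1 is 1 modulo q, so the weight determines s, and then r. *)
Lemma wt_inj r s r' s' : (s < q)%N -> (s' < q)%N -> wt q r s = wt q r' s' ->
  r = r' /\ s = s'.
Proof.
rewrite /wt => sq s'q e.
have e' : ((r + s) * q + s = (r' + s') * q + s')%N by nia.
have es : s = s'.
  by have := congr1 (modn^~ q) e'; rewrite /= !modnMDl !modn_small.
by split=> //; move: e'; rewrite es; nia.
Qed.

Lemma wt_canon r s : exists r' s', [/\ (s' < q)%N & wt q r' s' = wt q r s].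
Proof.
exists (r + s %/ q * q.+1)%N, (s %% q)%N; rewrite ltn_mod ltnW //; split=> //.
by rewrite /wt {3}(divn_eq s q); ring.
Qed.

Definition has_lead (D : {set point F}) n :=
  exists f, [/\ vanishing_ideal D f, below q n.+1 f & topcoef q n f != 0].

Lemma no_lead D n f : ~ has_lead D n -> vanishing_ideal D f -> below q n.+1 f ->
  topcoef q n f = 0.
Proof. by move=> nl fD fn; apply/eqP; apply: contra_notT nl => f0; exists f. Qed.

Lemma has_leadM D n r s : has_lead D n -> has_lead D (n + wt q r s).
Proof.
case=> f [fD fn f0]; exists (f * mono F r s); split.
- by move=> P PD; rewrite mevalM fD ?mul0r.
- by apply: belowM => //; rewrite below_mono.
by rewrite topcoefM ?below_mono // topcoef_mono eqxx mulr1.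
Qed.

(** If I_D were (H, h), the order of h would divide in the weight semigroup the
    order of every element of I_D. The weights i q with i <= q and j (q + 1)
    with j < q have only the divisor 0 in common, so h would be a nonzero
    constant modulo H and D would be empty. *)
Lemma not_type_i (D : {set point F}) i j P : P \in D -> (i <= q)%N -> (j < q)%N ->
  has_lead D (i * q) -> has_lead D (j * q.+1) -> ~ type_i q D.
Proof.
move=> PD iq jq [f [fD fi f0]] [g [gD gj g0]] [h DH].
have notH k f' : below q k.+1 f' -> topcoef q k f' != 0 -> ~ exists u, f' = u * H.
  move=> fk; apply: contra_neq_not => -[u e]; move: fk; rewrite e.
  exact: topcoef_multiple.
have [[v hv]|[k [w [hk hk0]]]] := reduce_hermitian h.
  apply: (notH _ _ fi f0); have /(DH f) := fD.
  by move/ideal_generated2 => [a [b ->]]; exists (a + b * v); rewrite hv; ring.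
(* An element of I_D is congruent to b h modulo H, so its order is the sum of
   the orders k of h and of b. *)
have split_lead n f' : vanishing_ideal D f' -> below q n.+1 f' ->
    topcoef q n f' != 0 -> exists r s, n = (k + wt q r s)%N.
  move=> f'D fn fn0; have /(DH f')/ideal_generated2 [a [b e]] := f'D.
  have [[v bv]|[l [v [bl bl0]]]] := reduce_hermitian b.
    by case: (notH _ _ fn fn0); exists (a + v * h); rewrite e bv; ring.
  have [r [s el]] := topcoef_neq0 bl0; exists r, s; rewrite -el addnC.
  apply: (order_unique fn fn0 (belowM bl hk)); first by rewrite topcoefM // mulf_neq0.
  instantiate (1 := a + v * h + b * w - v * w * H); rewrite e; ring.
have [r0 [s0 ek]] := topcoef_neq0 hk0.
have [r1 [s1 e1]] := split_lead _ _ fD fi f0.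
have [r2 [s2 e2]] := split_lead _ _ gD gj g0.
have [s00 r00] : s0 = 0%N /\ r0 = 0%N.
  have s00 : s0 = 0%N.
    move: e1; rewrite ek /wt => e1; clear -e1 iq q_gt1.
    have e : ((r0 + r1 + s0 + s1) * q + (s0 + s1) = i * q)%N by nia.
    have := congr1 (modn^~ q) e; rewrite /= modnMDl modnMl.
    have [lt|ge] := ltnP (s0 + s1) q; [by rewrite modn_small //; lia|nia].
  split=> //; move: e2; rewrite ek s00 /wt => e2.
  have e : ((r0 + r2 + s2) * q + s2 = j * q + j)%N by nia.
  have := congr1 (modn^~ q) e; rewrite /= !modnMDl (modn_small jq) => es.
  have js2 : (j <= s2)%N by rewrite (divn_eq s2 q) es leq_addl.
  have le : (j * q.+1 <= s2 * q.+1)%N by rewrite leq_mul2r js2 orbT.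
  have /eqP : (r0 * q = 0)%N by move: e2 le; clear; lia.
  by rewrite muln_eq0 => /orP [/eqP //|]; lia.
have k0 : k = 0%N by rewrite ek s00 r00.
have hP : (h - w * H).@[P] = 0.
  rewrite mevalB mevalM; have /DH hD : ideal_generated [:: H; h] h.
    by apply/ideal_generated2; exists 0, 1; rewrite mul0r add0r mul1r.
  have /DH HD : ideal_generated [:: H; h] H.
    by apply/ideal_generated2; exists 1, 0; rewrite mul0r addr0 mul1r.
  by rewrite hD ?HD // mulr0 subrr.
move: hk hk0 hP; rewrite k0; move: (h - w * H) => c c1.
(* Weights below 1 leave only the constant monomial. *)
have cC : c = (c@_0%MM)%:MP.
  apply/mpolyP => m; rewrite mcoeffC; have [<-|ne] := eqVneq 0%MM m; first by rewrite mulr1.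
  rewrite mulr0; apply/eqP; rewrite mcoeff_eq0; apply/negP => /(belowP _ _ _ c1).
  move=> mw; case/eqP: ne; apply/mnmP => -[[|[|//]] lt]; rewrite mnm0E.
    have -> : Ordinal lt = 0 by apply: val_inj.
    by move: mw; rewrite /weight; nia.
  have -> : Ordinal lt = 1 by apply: val_inj.
  by move: mw; rewrite /weight; nia.
rewrite cC mevalC => + c0; rewrite c0 topcoef_below ?eqxx // below0 //.
Qed.

End Footprint.

(** * Divisors of a missing leading weight *)

Section Supports.
Set Implicit Arguments.
Unset Strict Implicit.
Unset Printing Implicit Defensive.
Import GRing.Theory.
Local Open Scope ring_scope.

(** Evaluation on D embeds the span of the g i into the functions on D. Counting
    elements over the finite field replaces linear algebra: an injection between
    sets of equal cardinality is onto. *)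
Lemma interpolation (F : finFieldType) (I : finType) (g : I -> {mpoly F[2]})
    (D : {set point F}) :
  (forall c : I -> F, vanishing_ideal D (\sum_i c i *: g i) -> forall i, c i = 0) ->
  (#|I| <= #|D|)%N /\
  (#|I| = #|D| -> forall f, exists c : I -> F,
     vanishing_ideal D (f - \sum_i c i *: g i)).
Proof.
move=> free_g.
pose ev (f : {mpoly F[2]}) : {ffun {P : point F | P \in D} -> F} :=
    [ffun P : {P : point F | P \in D} => f.@[sval P : point F]].
pose comb (c : {ffun I -> F}) := \sum_i c i *: g i.
have evP f f' : ev f = ev f' -> vanishing_ideal D (f - f').
  move=> /ffunP e P PD; have := e (exist _ P PD).
  by rewrite !ffunE /= mevalB => ->; rewrite subrr.
have inj : injective (ev \o comb).
  move=> c c' /evP; rewrite /comb -sumrB.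
  under eq_bigr do rewrite -scalerBl.
  move=> /(free_g (fun i => c i - c' i)) e; apply/ffunP => i.
  by apply/eqP; rewrite -subr_eq0 e.
have F1 : (1 < #|F|)%N by rewrite (cardD1 0) (cardD1 1) !inE oner_eq0.
have cD : #|{: {P : point F | P \in D}}| = #|D| by rewrite card_sig; apply: eq_card.
split.
  have := leq_card _ inj; rewrite !card_ffun cD leq_exp2l //.
move=> eID f.
have [c' _ cc] : bijective (ev \o comb).
  by apply: inj_card_bij inj _; rewrite !card_ffun cD eID.
by exists (c' (ev f)); apply: evP; rewrite -[LHS]cc.
Qed.

Variables (F : finFieldType) (q : nat).
Hypothesis q1 : (1 < q)%N.
Notation A := {mpoly F[2]}.
Notation H := (hermitian_poly F q).
Notation E := (hermitian_points F q).

(** The divisors x^r y^s, s < q, of the weight of x^a y^b: the rectangle r <= a,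
    s <= b, and the rectangle r < a - q, b < s < q, whose cofactors use
    y^q = x^(q+1) up to lower weight. The sum type makes the cardinality
    immediate. *)
Definition divisor_index (a b : nat) : finType :=
  ('I_a.+1 * 'I_b.+1 + 'I_(a - q) * 'I_(q.-1 - b))%type.

Definition xdeg a b (i : divisor_index a b) : nat :=
  match i with inl u => u.1 | inr u => u.1 end.
Definition ydeg a b (i : divisor_index a b) : nat :=
  match i with inl u => u.2 | inr u => (b.+1 + u.2)%N end.

Notation dmono i := (mono F (xdeg i) (ydeg i)).
Notation dwt i := (wt q (xdeg i) (ydeg i)).

Lemma card_divisor_index a b : #|divisor_index a b| = nu q a b.
Proof. by rewrite card_sum !card_prod !card_ord. Qed.

Section Divisors.
Variables (a b : nat).
Hypothesis bq : (b < q)%N.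
Notation I := (divisor_index a b).

Lemma divisor_index_mem r s :
  (s < q)%N -> ((r <= a) && (s <= b) || (r < a - q))%N ->
  exists i : I, xdeg i = r /\ ydeg i = s.
Proof.
move=> sq; have [sb|bs] := leqP s b => rs.
  have [ra sb'] : (r < a.+1 /\ s < b.+1)%N by lia.
  by exists (inl (Ordinal ra, Ordinal sb')).
have [ra sb'] : (r < a - q /\ s - b.+1 < q.-1 - b)%N by lia.
by exists (inr (Ordinal ra, Ordinal sb')); split=> //=; lia.
Qed.

Lemma divisor_indexP (i : I) :
  ((xdeg i <= a) && (ydeg i <= b) || (xdeg i < a - q))%N /\ (ydeg i < q)%N.
Proof.
case: i => -[r s] /=; have := ltn_ord r; have := ltn_ord s; lia.
Qed.

Lemma dwt_inj (i j : I) : dwt i = dwt j -> i = j.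
Proof.
move=> eij; have [iN iq] := divisor_indexP i; have [jN jq] := divisor_indexP j.
have [] := wt_inj q1 iq jq eij; move: i j {eij iN iq jN jq} => [[r s]|[r s]] [[r' s']|[r' s']] /=.
- by move=> /val_inj -> /val_inj ->.
- by have := ltn_ord s; lia.
- by have := ltn_ord s'; lia.
by move=> /val_inj -> /addnI /val_inj ->.
Qed.

(** In the second rectangle the cofactor is x^(a-r-q-1) y^(q+b-s). *)
Lemma divisor_cofactor (i : I) : exists r s, (dwt i + wt q r s = wt q a b)%N.
Proof.
have [iN iq] := divisor_indexP i.
have [/andP [ra sb]|] := boolP ((xdeg i <= a) && (ydeg i <= b))%N.
  exists (a - xdeg i)%N, (b - ydeg i)%N; rewrite /wt.
  by rewrite addnACA -!mulnDl !subnKC.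
move=> /negPf nin; move: iN; rewrite nin /= => ra.
move: (xdeg i) (ydeg i) ra iq {nin} => r0 s0 ra iq.
exists (a - r0 - q.+1)%N, (q + b - s0)%N.
have [x ex] : exists x, a = (x + q.+1 + r0)%N by exists (a - r0 - q.+1)%N; lia.
have [y ey] : exists y, (q + b = y + s0)%N by exists (q + b - s0)%N; lia.
rewrite ey ex !addnK /wt.
have : ((q + b) * q.+1 = (y + s0) * q.+1)%N by rewrite ey.
by rewrite !mulnDl; lia.
Qed.

Definition comb (c : I -> F) : A := \sum_i c i *: dmono i.

Definition dmnm (i : I) : 'X_{1..2} := (U_(0%R) *+ xdeg i + U_(1%R) *+ ydeg i)%MM.

Lemma weight_dmnm i : weight q (dmnm i) = dwt i.
Proof.
by rewrite /weight !mnmDE !mulmnE !mnm1E /= ?(muln0, muln1, mul1n, mul0n, addn0, add0n).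
Qed.

Lemma dmnm_inj : injective dmnm.
Proof. by move=> i j eij; apply: dwt_inj; rewrite -!weight_dmnm eij. Qed.

Lemma coef_comb c i : (comb c)@_(dmnm i) = c i.
Proof.
rewrite /comb raddf_sum (bigD1 i) //= mcoeffZ mono_mpolyX mcoeffX eqxx mulr1.
rewrite big1 ?addr0 // => j ji; rewrite mcoeffZ mono_mpolyX mcoeffX.
by rewrite (inj_eq dmnm_inj) (negPf ji) mulr0.
Qed.

Lemma msupp_comb c m : m \in msupp (comb c) -> exists i, m = dmnm i.
Proof.
move=> /msupp_sum_le /flatten_mapP [i _ /msuppZ_le].
by rewrite mono_mpolyX msuppX inE => /eqP ->; exists i.
Qed.

Variable D : {set point F}.
Hypothesis no_lead_ab : ~ has_lead q D (wt q a b).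

Lemma no_lead_divisor (i : I) : ~ has_lead q D (dwt i).
Proof.
have [r [s e']] := divisor_cofactor i.
by move/(has_leadM r s); rewrite e'.
Qed.

(** The elements of the support of weight at least t have pairwise distinct
    weights, none of which is a leading weight of I_D; so the bound on the weight
    can be lowered step by step down to t. *)
Lemma below_vanishing t f : vanishing_ideal D f ->
  (forall m, m \in msupp f -> (weight q m < t)%N \/ exists i, m = dmnm i) ->
  below q t f.
Proof.
move=> fD fm; have [n] : exists n, below q n f by exists (size (@grading F q f)); apply: leqnn.
elim: n => [|n IH] fn; first exact: belowW fn.
have [nt|tn] := ltnP n t; first exact: belowW fn.
apply: IH; apply/belowP => m mf; have := belowP _ _ _ fn m mf.
rewrite ltnS leq_eqVlt => /orP [/eqP mn|//]; exfalso.
have [i ei] : exists i, m = dmnm i by case: (fm m mf) => //; rewrite mn ltnNge tn.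
have wi : dwt i = n by rewrite -weight_dmnm -ei.
have := no_lead (@no_lead_divisor i) fD; rewrite wi => /(_ fn).
rewrite topcoefE -big_filter.
rewrite (_ : [seq _ <- _ | _] = [:: m]).
  by rewrite big_seq1; apply/eqP; rewrite -mcoeff_msupp.
rewrite -(filter_pred1_uniq (msupp_uniq f) mf); apply: eq_in_filter => m' m'f /=.
apply/eqP/eqP => [m'n|-> //].
have [|[j ej]] := fm m' m'f; first by rewrite m'n ltnNge tn.
by rewrite ei ej; congr dmnm; apply: dwt_inj; rewrite wi -weight_dmnm -ej.
Qed.

Lemma comb_vanishing c : vanishing_ideal D (comb c) -> forall i, c i = 0.
Proof.
move=> cD i; rewrite -coef_comb (_ : comb c = 0) ?mcoeff0 //.
by apply: (@below0P F q); apply: below_vanishing => // m /msupp_comb; right.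
Qed.

Lemma nu_le_card : (nu q a b <= #|D|)%N.
Proof. by rewrite -card_divisor_index; case: (interpolation comb_vanishing). Qed.

Hypothesis card_D : #|D| = nu q a b.

Lemma normal_form f : exists c, vanishing_ideal D (f - comb c).
Proof.
by have [_] := interpolation comb_vanishing; apply; rewrite card_divisor_index.
Qed.

(** In the case of equality every weight that does not divide the missing one is
    a leading weight of I_D, and it is attained by a monomial corrected by
    divisors of smaller weight. *)
Lemma vanishing_mono r s : (forall i : I, dwt i <> wt q r s) ->
  exists2 c, vanishing_ideal D (mono F r s - comb c) & below q (wt q r s) (comb c).
Proof.
move=> new; have [c cD] := normal_form (mono F r s); exists c => //.
have : below q (wt q r s).+1 (mono F r s - comb c).
  apply: below_vanishing => // m /msuppB_le; rewrite mem_cat => /orP [|].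
    rewrite mono_mpolyX msuppX inE => /eqP ->; left.
    by rewrite /weight !mnmDE !mulmnE !mnm1E /= ?(muln0, muln1, mul1n, mul0n, addn0, add0n).
  by move/msupp_comb; right.
move=> /(belowB (_ : below q (wt q r s).+1 (mono F r s))) .
rewrite below_mono ltnSn opprB addrC subrK => /(_ isT) /belowP cle.
apply/belowP => m mc; have := cle m mc; rewrite ltnS leq_eqVlt => /orP [/eqP|//].
by have [i ->] := msupp_comb mc; rewrite weight_dmnm => /new.
Qed.

Lemma subspace_comb : subspace (fun f => exists c, f = comb c).
Proof.
split; first by exists (fun=> 0); rewrite /comb big1 // => i _; rewrite scale0r.
move=> x _ _ [c ->] [c' ->]; exists (fun i => x * c i + c' i).
rewrite /comb scaler_sumr -big_split /=; apply: eq_bigr => i _.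
by rewrite scalerDl scalerA.
Qed.

Lemma subspace_ideal f g : subspace (ideal_generated [:: f; g] : A -> Prop).
Proof.
split; first by apply/ideal_generated2; exists 0, 0; rewrite !mul0r addr0.
move=> x h h' /ideal_generated2 [u [v ->]] /ideal_generated2 [u' [v' ->]].
apply/ideal_generated2; exists (x *: u + u'), (x *: v + v').
by rewrite scalerDr !mulrDl -!scalerAl; ring.
Qed.

(** Two elements of I_D generate it as soon as they reduce every monomial to
    divisors: the remainder of an element of I_D is then in I_D, hence zero. *)
Lemma complete_intersection_of_division f g :
  vanishing_ideal D f -> vanishing_ideal D g ->
  (forall r s, exists c h, below q (wt q r s) h /\
     ideal_generated [:: f; g] (mono F r s - comb c - h)) ->
  complete_intersection D f g.
Proof.
move=> fD gD red h.
have JD h' : ideal_generated [:: f; g] h' -> vanishing_ideal D h'.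
  move=> /ideal_generated2 [u [v ->]] P PD.
  by rewrite mevalD !mevalM fD ?gD // !mulr0 addr0.
split=> [hD|]; last exact: JD.
have [|_ [c ->] hc] := @division F q _ _ (subspace_ideal f g) subspace_comb _ h.
  move=> r s; have [c [h' [h'lt Jh]]] := red r s.
  by exists (comb c), h'; split=> //; exists c.
suff c0 : comb c = 0 by move: hc; rewrite c0 subr0.
rewrite /comb big1 // => i _; rewrite (@comb_vanishing c) ?scale0r // => P PD.
have -> : comb c = h - (h - comb c) by ring.
by rewrite mevalB hD // (JD _ hc) // subrr.
Qed.

End Divisors.
End Supports.

Section Types.
Set Implicit Arguments.
Unset Strict Implicit.
Unset Printing Implicit Defensive.
Import GRing.Theory.
Local Open Scope ring_scope.

(** * Arithmetic of the bound *)

Lemma nu_le_q q a b : (a <= q)%N -> nu q a b = (a.+1 * b.+1)%N.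
Proof. by rewrite -subn_eq0 /nu => /eqP ->; rewrite mul0n addn0. Qed.

Lemma nu_type_i_ge q a b : (1 < q)%N ->
  (b < q)%N -> ~~ ((a < q) && (b < q.-1))%N -> (q <= nu q a b)%N.
Proof.
move=> q1; rewrite negb_and -!leqNgt /nu => bq /orP [qa|qb]; last first.
  have -> : b = q.-1 by lia.
  by rewrite prednK ?(ltnW q1) //; apply: leq_trans (leq_addr _ _); apply: leq_pmull.
nia.
Qed.

Lemma nu_ge_weight q a b : (1 < q)%N -> (b < q)%N -> (q.-1 * q <= wt q a b)%N -> (q <= nu q a b)%N.
Proof.
move=> q1 bq wq; have [ab|] := boolP ((a < q) && (b < q.-1))%N; last exact: nu_type_i_ge.
case/andP: ab => aq' bq'; rewrite nu_le_q ?(ltnW aq') //.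
have : (q.-1 <= a + b)%N by rewrite leqNgt; apply/negP => lt; move: wq; rewrite /wt; nia.
nia.
Qed.

(** Compare x^a y^b with the largest weight of the same block, the monomials of
    degree a + b in x and y: this is y^(a+b) if a + b < q, and
    x^(a+b-q+1) y^(q-1) otherwise, with nu equal to (a + b - q + 2) q. In the
    second case the inequality reads (q - a - 1) (q - b - 1) <= 0. *)
Lemma nu_ge_type_ii q a b : (a < q)%N -> (b < q.-1)%N -> (q <= nu q a b)%N ->
  (forall a' b', (a' < q ^ 2)%N -> (b' < q)%N -> (wt q a b < wt q a' b')%N ->
     (nu q a b <= nu q a' b')%N) -> a = q.-1.
Proof.
move=> aq bq; rewrite nu_le_q ?(ltnW aq) // => nuq min; have q0 : (0 < q)%N by lia.
have [small|large] := ltnP (a + b) q.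
  have a0 : (0 < a)%N by case: a nuq {aq min small} => // ; lia.
  have := min 0%N (a + b)%N _ small; rewrite nu_le_q //.
  have -> : (0 < q ^ 2)%N by rewrite expn_gt0 q0.
  have -> : (wt q a b < wt q 0 (a + b))%N by rewrite /wt mulnDl mulnS; lia.
  move=> /(_ isT isT) le; have ab0 : (a * b)%N = 0%N by nia.
  have b0 : b = 0%N by nia.
  by move: nuq; rewrite b0 muln1; lia.
have := min (a + b - q).+1 q.-1; rewrite nu_le_q ?prednK //; last by lia.
have -> : ((a + b - q).+1 < q ^ 2)%N by nia.
have [x ex] : exists x, (a + b = q + x)%N by exists (a + b - q)%N; lia.
have -> : (wt q a b < wt q (a + b - q).+1 q.-1)%N.
  by rewrite /wt ex addKn; nia.
move=> /(_ isT _ isT) le.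
have {}le : (a.+1 * b.+1 <= (a + b - q).+2 * q)%N by apply: le; lia.
rewrite ex addKn in le.
have [y ey] : exists y, q = (a.+1 + y)%N by exists (q - a.+1)%N; lia.
have [z ez] : exists z, q = (b.+2 + z)%N by exists (q - b.+2)%N; lia.
suff : y = 0%N by lia.
nia.
Qed.

Variables (F : finFieldType) (p e q : nat) (p_prime : prime p) (e_gt0 : (0 < e)%N).
Hypotheses (q_def : q = (p ^ e)%N) (card_F : #|F| = (q ^ 2)%N).
Notation A := {mpoly F[2]}.
Notation H := (hermitian_poly F q).
Notation E := (hermitian_points F q).

Let q1 : (1 < q)%N := q_gt1 p_prime e_gt0 q_def.

(** * The type of a support that attains the bound *)

Section Support.
Variables (a b : nat) (D : {set point F}).
Hypotheses (bq : (b < q)%N) (DE : {subset D <= E}).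
Hypothesis no_lead_ab : ~ has_lead q D (wt q a b).
Hypothesis card_D : #|D| = nu q a b.

Lemma comb_delta (i : divisor_index q a b) :
  comb (fun j => (j == i)%:R) = mono F (xdeg i) (ydeg i).
Proof.
rewrite /comb (bigD1 i) //= eqxx scale1r big1 ?addr0 // => j /negPf ->.
by rewrite scale0r.
Qed.

Lemma comb0 : @comb F q a b (fun=> 0) = 0.
Proof. by rewrite /comb big1 // => i _; rewrite scale0r. Qed.

Lemma monoB_below r s g : below q (wt q r s) g ->
  below q (wt q r s).+1 (mono F r s - g) /\ topcoef q (wt q r s) (mono F r s - g) = 1.
Proof.
move=> gl; split; first by rewrite belowB ?below_mono // (belowW (leqnSn _)).
by rewrite topcoefB topcoef_mono eqxx (topcoef_below gl) subr0.
Qed.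

Lemma vanishing_hermitian : vanishing_ideal D H.
Proof. by move=> P /DE PE; rewrite meval_hermitian. Qed.

(** The weights that do not divide that of x^a y^b are the multiples of a single
    weight, that of the second generator of I_D next to H. For b = q - 1 it is
    the weight of x^(a+1), otherwise that of x^(a-q) y^(b+1). *)
Lemma principal_generator : (q <= a)%N \/ b = q.-1 -> exists r0 s0,
  (forall i : divisor_index q a b, wt q (xdeg i) (ydeg i) <> wt q r0 s0) /\
  forall r s, (s < q)%N ->
    (exists i : divisor_index q a b, xdeg i = r /\ ydeg i = s) \/
    exists r1 s1, wt q r s = (wt q r0 s0 + wt q r1 s1)%N.
Proof.
move=> ab; have [bq1|bq1] := eqVneq b q.-1.
  exists a.+1, 0%N; split=> [i|r s sq].
    have [iN iq] := divisor_indexP q1 bq i.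
    by case/(wt_inj q1 iq (ltnW q1)) => ex ey; move: iN; rewrite ex ey; lia.
  have [ra|ar] := leqP r a.
    by left; apply: (divisor_index_mem q1 bq) => //; rewrite ra /=; lia.
  right; exists (r - a.+1)%N, s; rewrite /wt addnACA -!mulnDl subnKC //.
have {ab} qa : (q <= a)%N by case: ab => // eb; rewrite eb eqxx in bq1.
have bq' : (b.+1 < q)%N by lia.
exists (a - q)%N, b.+1; split=> [i|r s sq].
  have [iN iq] := divisor_indexP q1 bq i.
  by case/(wt_inj q1 iq bq') => ex ey; move: iN; rewrite ex ey; lia.
have [rsN|] := boolP ((r <= a) && (s <= b) || (r < a - q))%N.
  by left; apply: (divisor_index_mem q1 bq).
rewrite negb_or negb_and -!ltnNge ltnS => /andP [out ge]; right.
have [bs|sb] := ltnP b s.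
  exists (r - (a - q))%N, (s - b.+1)%N; rewrite /wt addnACA -!mulnDl !subnKC //.
exists (r - a.+1)%N, (s + q - b.+1)%N.
have [x ex] : exists x, a = (q + x)%N by exists (a - q)%N; rewrite subnKC.
have [y ey] : exists y, r = (a.+1 + y)%N by exists (r - a.+1)%N; lia.
have [z ez] : exists z, q = (b.+1 + z)%N by exists (q - b.+1)%N; lia.
have -> : (s + q - b.+1 = s + z)%N by lia.
have -> : (r - a.+1 = y)%N by lia.
have -> : (a - q = x)%N by lia.
rewrite /wt ey ex; have : (q * q.+1 = (b.+1 + z) * q.+1)%N by rewrite -ez.
by rewrite !mulnDl mulSn; lia.
Qed.

Lemma type_i_support : (q <= a)%N \/ b = q.-1 -> type_i q D.
Proof.
case/principal_generator => r0 [s0 [new cover]].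
have [c0 gD /monoB_below] := vanishing_mono q1 bq no_lead_ab card_D new.
move: gD; set g := mono F r0 s0 - _ => gD [glow g1]; exists g.
apply: (complete_intersection_of_division q1 bq no_lead_ab _ gD).
  exact: vanishing_hermitian.
move=> r s; have [r' [s' [s'q wE]]] := wt_canon q1 r s.
case: (cover r' s' s'q) => [[i [ex ey]]|[r1 [s1 w1]]].
  have [u uP] : congr_top q (wt q r s) (mono F r s) (mono F (xdeg i) (ydeg i)).
    by apply: congr_top_mono; rewrite // -wE ex ey.
  exists (fun j => (j == i)%:R), (mono F r s - mono F (xdeg i) (ydeg i) - u * H).
  split=> //; apply/ideal_generated2; exists u, 0; rewrite comb_delta; ring.
(* The product g x^r1 y^s1 has the leading term of x^r y^s modulo H, though
   its leading monomial may differ. *)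
have ts : below q (wt q r s).+1 (mono F r s - g * mono F r1 s1).
  by rewrite belowB ?below_mono // -wE w1 belowM // below_mono.
have t0 : topcoef q (wt q r s) (mono F r s - g * mono F r1 s1) = 0.
  rewrite topcoefB topcoef_mono eqxx -wE w1 topcoefM ?below_mono // g1.
  by rewrite topcoef_mono eqxx mulr1 subrr.
have [u uP] := congr_top0 q1 ts t0.
exists (fun=> 0), (mono F r s - g * mono F r1 s1 - 0 - u * H); split=> //.
apply/ideal_generated2; exists u, (mono F r1 s1); rewrite comb0; ring.
Qed.

(** Here the divisors form a rectangle, whose complement in the monomials is
    generated by x^(a+1) and y^(b+1): two elements of I_D with these leading
    monomials generate I_D. For the failure of type (i), the same two weights
    enter not_type_i. *)
Lemma type_ii_support : (a < q)%N -> (b < q.-1)%N -> type_ii q D.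
Proof.
move=> aq bq1.
have N0 (i : divisor_index q a b) : (xdeg i <= a /\ ydeg i <= b)%N.
  by have [] := divisor_indexP q1 bq i; lia.
have newx (i : divisor_index q a b) : wt q (xdeg i) (ydeg i) <> wt q a.+1 0.
  have [_ iq] := divisor_indexP q1 bq i; case/(wt_inj q1 iq (ltnW q1)) => ex _.
  by have := N0 i; lia.
have newy (i : divisor_index q a b) : wt q (xdeg i) (ydeg i) <> wt q 0 b.+1.
  have [_ iq] := divisor_indexP q1 bq i.
  have bq2 : (b.+1 < q)%N by lia.
  by case/(wt_inj q1 iq bq2) => _ ey; have := N0 i; lia.
have [c fD cl] := vanishing_mono q1 bq no_lead_ab card_D newx.
have [d gD dl] := vanishing_mono q1 bq no_lead_ab card_D newy.
split.
  exists (mono F a.+1 0 - comb c), (mono F 0 b.+1 - comb d).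
  apply: (complete_intersection_of_division q1 bq no_lead_ab fD gD).
  move=> r s; have [ra|ar] := leqP r a; last first.
    exists (fun=> 0), (comb c * mono F (r - a.+1) s); split.
      have -> : wt q r s = (wt q a.+1 0 + wt q (r - a.+1) s)%N.
        by rewrite /wt addnACA -!mulnDl subnKC.
      by rewrite below_mul_lt // below_mono.
    apply/ideal_generated2; exists (mono F (r - a.+1) s), 0.
    by rewrite comb0 -{1}(subnKC ar) -[in LHS](add0n s) -monoM; ring.
  have [sb|bs] := leqP s b; last first.
    exists (fun=> 0), (comb d * mono F r (s - b.+1)); split.
      have -> : wt q r s = (wt q 0 b.+1 + wt q r (s - b.+1))%N.
        by rewrite /wt addnACA -!mulnDl subnKC.
      by rewrite below_mul_lt // below_mono.
    apply/ideal_generated2; exists 0, (mono F r (s - b.+1)).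
    by rewrite comb0 -{1}(subnKC bs) -[in LHS](add0n r) -monoM; ring.
  have [||i [ex ey]] := @divisor_index_mem q q1 a b bq r s; first by lia.
    by rewrite ra sb.
  exists (fun j => (j == i)%:R), 0; split; first exact: below0.
  by apply/ideal_generated2; exists 0, 0; rewrite comb_delta ex ey; ring.
have /card_gt0P [P PD] : (0 < #|D|)%N by rewrite card_D /nu mulSn.
apply: (not_type_i q1 PD aq (_ : b.+1 < q)%N); first by lia.
  have [h1 h2] := monoB_below cl; exists (mono F a.+1 0 - comb c).
  by move: h1 h2; rewrite /wt mul0n addn0 => h1 h2; split=> //; rewrite h2 oner_eq0.
have [h1 h2] := monoB_below dl; exists (mono F 0 b.+1 - comb d).
by move: h1 h2; rewrite /wt mul0n add0n => h1 h2; split=> //; rewrite h2 oner_eq0.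
Qed.

End Support.

(** * Minimum-weight codewords *)

(** The multiples of x^(q^2) - x vanish at every rational point. *)
Lemma has_lead_large (D : {set point F}) r s : (q ^ 2 <= r)%N -> has_lead q D (wt q r s).
Proof.
move=> qr; exists (mono F r s - mono F (r - (q ^ 2).-1) s).
have q20 : (1 < q ^ 2)%N by rewrite -(exp1n 2) ltn_exp2r.
have [] := @monoB_below r s (mono F (r - (q ^ 2).-1) s).
  by rewrite below_mono /wt ltn_add2r ltn_pmul2r ?(ltnW q1) //; lia.
move=> h1 h2; split=> //; last by rewrite h2 oner_eq0.
move=> P _; rewrite mevalB -(pt_eta P) !meval_mono.
have {1}-> : r = (q ^ 2 + (r - q ^ 2))%N by rewrite subnKC.
have -> : (r - (q ^ 2).-1 = 1 + (r - q ^ 2))%N by lia.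
by rewrite !exprD expr_qq // expr1 subrr.
Qed.

Lemma has_lead_reduce (D : {set point F}) r s : {subset D <= E} ->
  has_lead q D (wt q r s) ->
  exists2 h, below q (wt q r s) h & vanishing_ideal D (mono F r s - h).
Proof.
move=> DE [f [fD fl f0]]; have [u ul] := congr_top_coef q1 erefl fl.
exists (- (topcoef q (wt q r s) f)^-1 *:
  (f - topcoef q (wt q r s) f *: mono F r s - u * H)); first exact: belowZ.
move=> P PD; have uH0 : (u * H).@[P] = 0.
  by rewrite mevalM meval_hermitian ?mulr0 ?DE.
rewrite mevalB mevalZ [X in _ * X]mevalB uH0 subr0 mevalB mevalZ fD //.
by rewrite sub0r mulNr mulrN opprK mulKf // subrr.
Qed.

Lemma indicator (P : point F) : exists f : A, forall Q : point F,
  f.@[Q] = (Q == P)%:R.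
Proof.
pose g (i : 'I_2) : A := 1 - ('X_i - (P i)%:MP) ^+ (q ^ 2).-1.
have gE i Q : (g i).@[Q] = (Q i == P i)%:R.
  rewrite /g mevalB meval1 rmorphXn /= mevalB mevalXU mevalC -subr_eq0.
  have q20 : (1 < q ^ 2)%N by rewrite -(exp1n 2) ltn_exp2r.
  have [->|ne] := eqVneq (Q i - P i) 0.
    by rewrite expr0n (_ : ((q ^ 2).-1 == 0)%N = false) ?subr0 //; lia.
  apply/eqP; rewrite subr_eq0 eq_sym; apply/eqP/(mulfI ne).
  by rewrite -exprS prednK ?expr_qq ?mulr1 // ltnW.
exists (g 0 * g 1) => Q; rewrite mevalM !gE -natrM mulnb; congr (_%:R).
have [->|ne] := eqVneq Q P; first by rewrite !eqxx.
apply/eqP; rewrite eqb0; apply: contra ne => /andP [/eqP e0 /eqP e1].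
by rewrite -(pt_eta P) -(pt_eta Q) e0 e1.
Qed.

(** If each weight above m that comes from a < q^2 and b < q were a leading
    weight of I_D, division would reduce every polynomial modulo I_D to one of
    weight at most m, and c would be orthogonal to the indicator of each
    point. *)
Lemma exists_no_lead m (c : 'rV[F]_#|E|) : c \in hermitian_code F q m -> c != 0 ->
  exists a b, [/\ (a < q ^ 2)%N, (b < q)%N, (m < wt q a b)%N &
    ~ has_lead q (codeword_support c) (wt q a b)].
Proof.
move=> /(mem_hermitian_code card_F) cm; apply: contra_neqP => nex.
set D := codeword_support c in nex.
have DE : {subset D <= E} by move=> P; apply: codeword_support_point.
have sJ : subspace (vanishing_ideal D).
  split=> [P _|x f g fD gD P PD]; first by rewrite meval0.
  by rewrite mevalD mevalZ fD // gD // mulr0 addr0.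
have sS : subspace (below q m.+1 : A -> Prop).
  by split=> [|x f g fm gm]; [exact: below0 | rewrite belowD ?belowZ].
have red r s : exists g h, [/\ below q m.+1 g, below q (wt q r s) h &
    vanishing_ideal D (mono F r s - g - h)].
  have [le|gt] := leqP (wt q r s) m.
    exists (mono F r s), 0; split; rewrite ?below_mono ?below0 //.
    by move=> P _; rewrite subrr subr0 meval0.
  have lead : has_lead q D (wt q r s).
    have [a [b [bq wE]]] := wt_canon q1 r s; rewrite -wE.
    have [aq|qa] := ltnP a (q ^ 2); last exact: has_lead_large.
    by apply: contrapT => nl; apply: nex; exists a, b; rewrite wE; split=> //; rewrite -wE.
  have [h hl hD] := has_lead_reduce DE lead.
  by exists 0, h; split; rewrite ?below0 // subr0.
apply/rowP => i; rewrite mxE.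
have [f fP] := indicator (hermitian_point i).
have [g gm fgD] := @division F q _ _ sJ sS red f.
rewrite -[RHS](cm g gm) (bigD1 i) //=.
have ge j : c 0 j * g.@[hermitian_point j] = c 0 j * (j == i)%:R.
  have [->|cj] := eqVneq (c 0 j) 0; first by rewrite !mul0r.
  have /fgD : hermitian_point j \in D by apply: imset_f; rewrite inE.
  move/eqP; rewrite mevalB subr_eq0 fP => /eqP <-.
  by rewrite (inj_eq enum_val_inj).
rewrite ge eqxx mulr1 big1 ?addr0 // => j /negPf ji.
by rewrite ge ji mulr0.
Qed.

Notation C m := (hermitian_code F q m).

Lemma distance_le_nu m a b : (a < q ^ 2)%N -> (b < q)%N -> (m < wt q a b)%N ->
  (distance (C m) <= nu q a b)%N.
Proof.
move=> aq bq mw; have [c [S [T [cC cw _ _ _]]]] :=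
  exists_codeword p_prime e_gt0 q_def card_F aq bq mw.
rewrite -cw distance_le // -hamming_weight_eq0 cw /nu mulSn //.
Qed.

(** The lower bound by nu (a, b) for this word and the word of weight nu (a, b)
    that lies in the same code force equality. *)
Lemma min_weight_support m (c : 'rV[F]_#|E|) : min_weight_codeword (C m) c ->
  exists a b, [/\ (a < q ^ 2)%N, (b < q)%N, (m < wt q a b)%N,
    distance (C m) = nu q a b &
    if (a < q)%N && (b < q.-1)%N then type_ii q (codeword_support c)
    else type_i q (codeword_support c)].
Proof.
case=> cC c0 cd; have [a [b [aq bq mw nl]]] := exists_no_lead cC c0.
have dE : distance (C m) = nu q a b.
  apply/eqP; rewrite eqn_leq distance_le_nu //= -cd -card_codeword_support.
  refine (nu_le_card q1 bq nl).
have cD : #|codeword_support c| = nu q a b by rewrite card_codeword_support cd.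
have DE : {subset codeword_support c <= E} by move=> P; apply: codeword_support_point.
exists a, b; split=> //; case: ifPn => [/andP [aq' bq']|].
  exact: type_ii_support nl cD aq' bq'.
rewrite negb_and -!leqNgt => ab; apply: (type_i_support bq DE nl cD).
by case/orP: ab => [|bq']; [left|right; lia].
Qed.

End Types.

(** * Codes with both types of support *)

Section Main.
Set Implicit Arguments.
Unset Strict Implicit.
Unset Printing Implicit Defensive.
Import GRing.Theory.
Local Open Scope ring_scope.

Variables (F : finFieldType) (p e q : nat) (p_prime : prime p) (e_gt0 : (0 < e)%N).
Hypotheses (q_def : q = (p ^ e)%N) (card_F : #|F| = (q ^ 2)%N).
Notation A := {mpoly F[2]}.
Notation H := (hermitian_poly F q).
Notation E := (hermitian_points F q).
Notation C m := (hermitian_code F q m).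

Let q1 : (1 < q)%N := q_gt1 p_prime e_gt0 q_def.

(** A type (ii) support gives a = q - 1 and the distance (b + 1) q. A word from
    x^b y^(q-1), which has larger weight, has the same Hamming weight. Its
    support is of type (i): seen in the code C_m' with m' just below the weight
    of x^b y^(q-1), type (ii) would again mean the weight of x^(q-1) y^b, which
    is too small. *)
Lemma all_type_i_or_mixed m : (q <= distance (C m))%N ->
  all_supports_type_i F q m \/ mixed_supports F q m.
Proof.
move=> qd; have [|nall] := pselect (all_supports_type_i F q m); [by left|right].
have [c cmin ni] : exists2 c, min_weight_codeword (C m) c & ~ type_i q (codeword_support c).
  by apply: contrapT => nex; apply: nall => c cm; apply: contrapT => ni; apply: nex; exists c.
have [a [b [aq bq mw dE ty]]] := min_weight_support p_prime e_gt0 q_def card_F cmin.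
move: ty; case: ifPn => [/andP [aq' bq'] ii|_ /ni //].
have dmin := distance_le_nu p_prime e_gt0 q_def card_F.
have ea : a = q.-1.
  apply: (nu_ge_type_ii aq' bq'); first by rewrite -dE.
  by move=> a' b' a'q b'q lt; rewrite -dE dmin // (ltn_trans mw).
have q0 : (0 < q)%N by exact: ltnW.
have dq : distance (C m) = (b.+1 * q)%N by rewrite dE ea nu_le_q ?leq_pred // prednK // mulnC.
split; first by exists b.+1; rewrite ?dq.
  have bq2 : (b < q ^ 2)%N by nia.
  have qq : (q.-1 < q)%N by rewrite prednK.
  have wlt : (wt q a b < wt q b q.-1)%N by rewrite ea /wt; nia.
  pose m' := (wt q b q.-1).-1.
  have m'w : (m' < wt q b q.-1)%N by rewrite /m'; lia.
  have [c' [S [T [c'C c'w _ _ _]]]] := exists_codeword p_prime e_gt0 q_def card_F bq2 qq m'w.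
  have c'd : hamming_weight c' = distance (C m).
    by rewrite c'w nu_le_q ?(ltnW bq) // dq prednK.
  have sub : C m' \subset C m by apply: hermitian_code_sub; rewrite // /m'; lia.
  have c'0 : c' != 0 by rewrite -hamming_weight_eq0 c'd dq; nia.
  exists c'; first by split=> //; apply: (subsetP sub).
  have c'min : min_weight_codeword (C m') c'.
    split=> //; apply/eqP; rewrite eqn_leq distance_le // andbT.
    apply: distance_ge; first by rewrite -[X in (_ <= X)%N]card_ord max_card.
    by move=> c'' c''C c''0; rewrite c'd distance_le // (subsetP sub).
  have [a' [b' [a'q b'q m'w' dE' ty]]] := min_weight_support p_prime e_gt0 q_def card_F c'min.
  have dd : nu q a' b' = distance (C m) by rewrite -dE' -c'd; case: c'min.
  move: ty; case: ifPn => // /andP [a'q' b'q' _]; exfalso.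
  have ea' : a' = q.-1.
    apply: (nu_ge_type_ii a'q' b'q'); first by rewrite dd.
    by move=> x y xq yq lt; rewrite -dE' dmin // (ltn_trans m'w').
  have eb' : b' = b.
    move: dd; rewrite dq ea' nu_le_q ?leq_pred // prednK // mulnC => /eqP.
    by rewrite eqn_pmul2r // => /eqP [].
  by move: m'w'; rewrite ea' eb' -ea /m'; lia.
by exists c.
Qed.

(** For m = q^2 - q - 1 the word attached to x^(q-1) has q points on a line
    y = t, so I_D has the leading weights of x^q and of y. *)
Lemma exists_mixed : exists m : nat,
  [/\ (m <= q ^ 3 + q ^ 2 - q - 2)%N, (q <= distance (C m))%N & mixed_supports F q m].
Proof.
have q0 : (0 < q)%N by exact: ltnW.
pose m := (q.-1 * q).-1; exists m.
have a_lt : (q.-1 < q ^ 2)%N by nia.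
have mw : (m < wt q q.-1 0)%N by rewrite /wt /m; nia.
have [c [S [T [cC cw cS cT cP]]]] := exists_codeword p_prime e_gt0 q_def card_F a_lt q0 mw.
have {}cw : hamming_weight c = q by rewrite cw nu_le_q ?leq_pred // muln1 prednK.
have c0 : c != 0 by rewrite -hamming_weight_eq0 cw -lt0n.
have dq : (q <= distance (C m))%N.
  apply: distance_ge; first by rewrite -{1}cw -[X in (_ <= X)%N]card_ord max_card.
  move=> c' c'C c'0; have [a [b [aq bq mw' nl]]] :=
    exists_no_lead p_prime e_gt0 q_def card_F c'C c'0.
  rewrite -card_codeword_support; apply: (@leq_trans (nu q a b)).
    by apply: (nu_ge_weight q1) => //; move: mw'; rewrite /m; lia.
  refine (nu_le_card q1 bq nl).
split=> //; first by rewrite /m; nia.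
have [all_i|//] := all_type_i_or_mixed dq; exfalso.
have cmin : min_weight_codeword (C m) c.
  by split=> //; apply/eqP; rewrite eqn_leq distance_le // andbT cw.
have [P PD] : exists P, P \in codeword_support c.
  by apply/card_gt0P; rewrite card_codeword_support cw.
have [t eT] : exists t, T = [set t] by apply/cards1P; rewrite cT.
apply: (not_type_i q1 PD (leqnn q) q1) (all_i c cmin).
  have [blw top] := topcoef_prod (fun x (_ : x \in S) => below_vertical q1 x).
  exists (\prod_(x in S) vertical x).
  rewrite cS prednK // in blw top; split=> //.
    move=> Q /(cP (leq_pred q)) [QS _]; apply/eqP.
    by rewrite -[_ == 0]negbK meval_prod_neq0 negbK.
  by rewrite top big1 ?oner_eq0 // => x _; apply: topcoef_vertical.
exists (horizontal t); rewrite mul1n (below_horizontal q1) topcoef_horizontal oner_eq0.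
split=> // Q /(cP (leq_pred q)) [_]; rewrite eT inE => /eqP Qt.
by rewrite mevalB mevalXU mevalC Qt subrr.
Qed.

End Main.

Theorem theoremA (p e q : nat) (p_prime : prime p) (e_gt0 : 0 < e)
    (q_def : q = p ^ e) (F : finFieldType) (card_F : #|F| = q ^ 2) :
  (forall m : nat, m <= q ^ 3 + q ^ 2 - q - 2 ->
     [/\ forall c, min_weight_codeword (hermitian_code F q m) c ->
           type_i q (codeword_support c) \/ type_ii q (codeword_support c),
         distance (hermitian_code F q m) < q -> all_supports_type_ii F q m
       & q <= distance (hermitian_code F q m) ->
           all_supports_type_i F q m \/ mixed_supports F q m])
  /\ (exists m : nat,
        [/\ m <= q ^ 3 + q ^ 2 - q - 2,
            q <= distance (hermitian_code F q m)
          & mixed_supports F q m]).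
Proof.
split; last exact: exists_mixed p_prime e_gt0 q_def card_F.
have cls := min_weight_support p_prime e_gt0 q_def card_F.
move=> m _; split.
- move=> c /cls [a [b [_ _ _ _]]]; case: ifP; by [right|left].
- move=> dq c /cls [a [b [_ bq _ dE]]]; case: ifPn => // ab.
  by have := nu_type_i_ge (q_gt1 p_prime e_gt0 q_def) bq ab; rewrite -dE leqNgt dq.
exact: all_type_i_or_mixed p_prime e_gt0 q_def card_F m.
Qed.
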